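(* Let $\Omega$ be a bounded domain in $\mathbb{H}$. Suppose there exists a continuous strongly subharmonic function $\rho:\Omega\to(-\infty,0)$ such that $\{q\in\Omega:\rho(q)<c\}$ is relatively compact in $\Omega$ for all $c<0$. Then for all $q_0\in\Omega$ and for all $p\in\partial\Omega$ $$\lim_{q\to p}G^\Omega_{q_0}(q)=0 .$$ Moreover, $G^\Omega_{q_0}$ is continuous in $\Omega\setminus\{q_0\}$.
   Context: $\mathbb{H}$ is the real algebra of quaternions with its Euclidean norm and topology; a domain is a nonempty connected open set. $\mathbb{S}=\{q\in\mathbb{H}:q^2=-1\}$; for $I\in\mathbb{S}$, $L_I=\mathbb{R}+I\mathbb{R}\cong\mathbb{C}$. An upper semicontinuous $u:\Omega\to[-\infty,+\infty)$, $u\not\equiv-\infty$, is strongly subharmonic if, for every $I\in\mathbb{S}$, it is plurisubharmonic with respect to the constant complex structure on $\mathbb{H}$ given by left multiplication $v\mapsto Iv$ on each tangent space $T_q\mathbb{H}\cong\mathbb{H}$ (choosing $J\in\mathbb{S}$, $J\perp I$, this structure is identified with the standard one on $\mathbb{C}^2$ through $q=z_1+z_2J\mapsto(z_1,z_2)\in L_I^2$). For $q_0\in\Omega$, let $\mathsf{ssh}_{q_0}(\Omega)$ be the set of strongly subharmonic functions $u$ on $\Omega$ with $u<0$ and $\limsup_{q\to q_0}\big|u(q)-\log|q-q_0|\big|<\infty$. Let $s(q)=\sup\{u(q):u\in\mathsf{ssh}_{q_0}(\Omega)\}$ (and $s\equiv-\infty$ if $\mathsf{ssh}_{q_0}(\Omega)=\emptyset$).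 The strongly subharmonic Green function $G^\Omega_{q_0}$ of $\Omega$ with logarithmic pole at $q_0$ is the upper semicontinuous regularization $s^*$ of $s$. *)

(* Defs.v *)
From HB Require Import structures.
From mathcomp Require Import all_boot all_order all_algebra.
From mathcomp Require Import all_classical all_reals all_analysis.
From mathcomp Require Import ring.

Set Implicit Arguments.
Unset Strict Implicit.
Unset Printing Implicit Defensive.

Import Order.TTheory GRing.Theory Num.Theory.
Import numFieldNormedType.Exports.

Local Open Scope classical_set_scope.
Local Open Scope ring_scope.

(* The quaternion a + b i + c j + d k is the row vector (a, b, c, d).  Its
   topology is that of 'rV[R]_4, which is the Euclidean one.  Beware that the
   norm `|_| inherited from 'rV[R]_4 is the (equivalent) sup norm; the Euclidean
   norm is [qnorm]. *)
Definition quat (R : realType) : Type := 'rV[R]_4.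

HB.instance Definition _ (R : realType) := NormedModule.on (quat R).

Definition qcoord (R : realType) (q : quat R) (k : nat) : R :=
  (q : 'rV[R]_4) ord0 (inord k).

Definition mkquat (R : realType) (a b c d : R) : quat R :=
  \row_(i < 4) [:: a; b; c; d]`_i.

Lemma qcoord_mkquat (R : realType) (a b c d : R) k : (k < 4)%N ->
  qcoord (mkquat a b c d) k = [:: a; b; c; d]`_k.
Proof. by move=> k4; rewrite /qcoord mxE inordK. Qed.

Lemma qcoord_eqP (R : realType) (p q : quat R) :
  (forall k, (k < 4)%N -> qcoord p k = qcoord q k) -> p = q.
Proof.
move=> pq; apply/rowP => i.
by have := pq i (ltn_ord i); rewrite /qcoord inord_val.
Qed.

Lemma qcoordD (R : realType) (p q : quat R) k :
  qcoord (p + q) k = qcoord p k + qcoord q k.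
Proof. by rewrite /qcoord mxE. Qed.

Lemma qcoordZ (R : realType) (a : R) (q : quat R) k :
  qcoord (a *: q) k = a * qcoord q k.
Proof. by rewrite /qcoord mxE. Qed.

Section quaternion_algebra.
Variable R : realType.
Implicit Types p q r : quat R.

Local Notation "q ''_' k" := (qcoord q k%N) (at level 8, k at level 2).

Definition qone : quat R := mkquat 1 0 0 0.

Definition qmul p q : quat R := mkquat
  (p '_0 * q '_0 - p '_1 * q '_1 - p '_2 * q '_2 - p '_3 * q '_3)
  (p '_0 * q '_1 + p '_1 * q '_0 + p '_2 * q '_3 - p '_3 * q '_2)
  (p '_0 * q '_2 - p '_1 * q '_3 + p '_2 * q '_0 + p '_3 * q '_1)
  (p '_0 * q '_3 + p '_1 * q '_2 - p '_2 * q '_1 + p '_3 * q '_0).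

Let coords := (qcoord_mkquat, qcoordD, qcoordZ).

Lemma qmulA : associative qmul.
Proof.
move=> p q r; apply: qcoord_eqP => -[|[|[|[|//]]]] _;
  rewrite !coords //=; ring.
Qed.

Lemma qmul1q : left_id qone qmul.
Proof.
move=> q; apply: qcoord_eqP => -[|[|[|[|//]]]] _; rewrite !coords //=; ring.
Qed.

Lemma qmulq1 : right_id qone qmul.
Proof.
move=> q; apply: qcoord_eqP => -[|[|[|[|//]]]] _; rewrite !coords //=; ring.
Qed.

Lemma qmulDl : left_distributive qmul +%R.
Proof.
move=> p q r; apply: qcoord_eqP => -[|[|[|[|//]]]] _;
  rewrite !coords //=; ring.
Qed.

Lemma qmulDr : right_distributive qmul +%R.
Proof.
move=> p q r; apply: qcoord_eqP => -[|[|[|[|//]]]] _;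
  rewrite !coords //=; ring.
Qed.

Lemma qone_neq0 : qone != 0 :> quat R.
Proof.
apply/eqP => /(congr1 (fun q => qcoord q 0)).
by rewrite coords //= /qcoord mxE => /eqP; rewrite oner_eq0.
Qed.

HB.instance Definition _ := GRing.Zmodule_isNzRing.Build (quat R)
  qmulA qmul1q qmulq1 qmulDl qmulDr qone_neq0.

Lemma qscalerAl (a : R) p q : a *: (p * q) = (a *: p) * q.
Proof.
apply: qcoord_eqP => -[|[|[|[|//]]]] _; rewrite !coords //=; ring.
Qed.

Lemma qscalerAr (a : R) p q : a *: (p * q) = p * (a *: q).
Proof.
apply: qcoord_eqP => -[|[|[|[|//]]]] _; rewrite !coords //=; ring.
Qed.

HB.instance Definition _ := GRing.Lmodule_isLalgebra.Build R (quat R) qscalerAl.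
HB.instance Definition _ := GRing.Lalgebra_isAlgebra.Build R (quat R) qscalerAr.

End quaternion_algebra.

Definition qnorm (R : realType) (q : quat R) : R :=
  Num.sqrt (\sum_(k < 4) qcoord q k ^+ 2).

Definition imag_unit (R : realType) : set (quat R) := [set I | I ^+ 2 = -1].

(* The identification C = R * R -> L_I, x + iy |-> x + Iy. *)
Definition slice (R : realType) (I : quat R) (z : R * R) : quat R :=
  z.1%:A + z.2 *: I.

Definition usc_on (T : topologicalType) (R : realType) (D : set T)
    (f : T -> \bar R) : Prop :=
  forall x, D x -> forall a : R, (f x < a%:E)%E ->
    \forall y \near within D (nbhs x), (f y < a%:E)%E.

Definition closed_disc (R : realType) (z : R * R) (r : R) : set (R * R) :=
  [set w | (w.1 - z.1) ^+ 2 + (w.2 - z.2) ^+ 2 <= r ^+ 2].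

Definition circle_mean (R : realType) (f : R * R -> \bar R) (z : R * R) (r : R)
    : \bar R :=
  (((2 * pi)^-1)%:E *
   \int[lebesgue_measure]_(t in `[0%R, (2 * pi)%R])
     f (z.1 + r * cos t, z.2 + r * sin t)%R)%E.

(* The function identically -oo (on some components) is allowed here. *)
Definition subharmonic (R : realType) (D : set (R * R)) (f : R * R -> \bar R)
    : Prop :=
  [/\ usc_on D f,
      forall z, D z -> (f z < +oo)%E &
      forall z r, 0 < r -> closed_disc z r `<=` D ->
        (f z <= circle_mean f z r)%E].

(* The complex affine lines of H, for the complex structure v |-> I v, are
   z |-> a + z b with z in L_I. *)
Definition plurisubharmonic (R : realType) (I : quat R) (Omega : set (quat R))
    (u : quat R -> \bar R) : Prop :=
  usc_on Omega u /\
  forall a b : quat R,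
    subharmonic [set z | Omega (a + slice I z * b)]
                (fun z => u (a + slice I z * b)).

(* Functions on Omega are represented by functions on H whose values outside
   Omega are irrelevant. *)
Definition strongly_subharmonic (R : realType) (Omega : set (quat R))
    (u : quat R -> \bar R) : Prop :=
  [/\ usc_on Omega u,
      forall q, Omega q -> (u q < +oo)%E,
      exists2 q, Omega q & u q != -oo%E &
      forall I, imag_unit I -> plurisubharmonic I Omega u].

Definition ssh (R : realType) (Omega : set (quat R)) (q0 : quat R)
    : set (quat R -> \bar R) :=
  [set u | [/\ strongly_subharmonic Omega u,
               forall q, Omega q -> (u q < 0)%E &
               (limf_esup (fun q => `|u q - (ln (qnorm (q - q0)))%:E|)
                          q0^' < +oo)%E]].

(* [ereal_sup set0 = -oo] covers the case where [ssh Omega q0] is empty. *)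
Definition ssh_sup (R : realType) (Omega : set (quat R)) (q0 q : quat R)
    : \bar R :=
  ereal_sup [set u q | u in ssh Omega q0].

(* The limsup defining the regularization is not punctured. *)
Definition usc_regularization (R : realType) (Omega : set (quat R))
    (f : quat R -> \bar R) (q : quat R) : \bar R :=
  limf_esup f (within Omega (nbhs q)).

Definition ssh_green (R : realType) (Omega : set (quat R)) (q0 : quat R)
    : quat R -> \bar R :=
  usc_regularization Omega (ssh_sup Omega q0).

Definition domain (R : realType) (Omega : set (quat R)) : Prop :=
  [/\ Omega !=set0, connected Omega & open Omega].

Definition boundary (T : topologicalType) (A : set T) : set T :=
  closure A `\` interior A.

Definition relatively_compact_in (T : topologicalType) (A B : set T) : Prop :=
  compact (closure A) /\ closure A `<=` B.

(* Main.v *)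
Require Import Defs.
From HB Require Import structures.
From mathcomp Require Import all_boot all_order all_algebra.
From mathcomp Require Import all_classical all_reals all_analysis.
From mathcomp Require Import measurable_realfun ring lra.

(* Everything rests on producing members of [ssh Omega q0] by gluing.  Gluing
   needs that subharmonicity is local: for [g >= 0] lower semicontinuous and
   locally super-mean, the integral [m s] of [g] over the circle of radius [s]
   is lower semicontinuous (Fatou) and locally super-mean (Tonelli and rotation
   invariance), so the minimum principle gives [m r <= m 0].

   Boundary values: [C rho], glued near [q0] to [log |q - q0| - log Rad], is a
   competitor, so the Green function is squeezed between [C rho] and [0] near
   the boundary.

   Continuity follows Walsh.  Right multiplications are complex linear for all
   the structures [v |-> I v] at once, so the maps
   [phi q = q + (q - q0) h = q0 + (q - q0) (1 + h)] preserve strong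
   subharmonicity; they fix the pole, and since the quaternions are a division
   ring they move any [q != q0] to every nearby point.  Gluing [u \o phi - eps]
   to the competitor above, which exceeds [- eps] near the boundary, gives
   [s (phi q) <= s q + eps] for small [h], where [s] is the upper envelope of
   [ssh Omega q0]; hence [s] is continuous off [q0] and equals its
   regularization there. *)

Set Implicit Arguments.
Unset Strict Implicit.
Unset Printing Implicit Defensive.

Import Order.TTheory GRing.Theory Num.Theory.
Import numFieldNormedType.Exports.

Local Open Scope classical_set_scope.
Local Open Scope ring_scope.

(** * Integration on the line and the plane *)

(** [subharmonic] tests every closed disc inside the domain, while a glued function is controlled
    only on discs that fit into one of two open pieces; this is why locality is the technical core.
    Functions may take the value [-oo] and their circle integrals may diverge, so each submean
    inequality is traded for a super-mean inequality of [M - u >= 0], [M] bounding [u] on a compact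
    disc: Fatou, Tonelli and monotonicity then require no integrability. Translations, the usual
    choice in Walsh's argument, would move the pole. The maps [phi] only add the constant
    [log |1 + h|] to [log |q - q0|], so the pole condition survives. They do not preserve [Omega];
    hence [u \o phi] is used only around a compact set, and one fixed competitor takes over outside.
    The size of [h] does not depend on [u] because every member of the class is negative:
    [u \o phi - eps] lies below [- eps], hence below the competitor near the boundary. The envelope
    itself never has to be shown subharmonic. *)

Lemma open_measurable_prod (R : realType) (U : set (R * R)) :
  open U -> @measurable _ (measurableTypeR R * measurableTypeR R)%type U.
Proof.
move=> oU.
pose box (a b c d : rat) : set (measurableTypeR R * measurableTypeR R) :=
  `]ratr a, ratr b[%classic `*` `]ratr c, ratr d[%classic.
pose Q (a b c d : rat) := box a b c d `<=` U.
have -> : U = \bigcup_a \bigcup_b \bigcup_c \bigcup_d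
    (if `[< Q a b c d >] then box a b c d else set0).
  apply/seteqP; split => [[x y] Uxy|z [a _ [b _ [c _ [d _]]]]]; last first.
    by case: ifP => // /asboolP; apply.
  have /nbhs_ballP[e /= e0 eU] : nbhs (x, y) U by exact: open_nbhs_nbhs.
  have [a /[!in_itv]/= /andP[a1 a2]] := @rat_in_itvoo R (x - e) x ltac:(lra).
  have [b /[!in_itv]/= /andP[b1 b2]] := @rat_in_itvoo R x (x + e) ltac:(lra).
  have [c /[!in_itv]/= /andP[c1 c2]] := @rat_in_itvoo R (y - e) y ltac:(lra).
  have [d /[!in_itv]/= /andP[d1 d2]] := @rat_in_itvoo R y (y + e) ltac:(lra).
  exists a => //; exists b => //; exists c => //; exists d => //.
  rewrite ifT; first by split; rewrite /= in_itv/= ?a2 ?b1 ?c2 ?d1.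
  apply/asboolP => -[s t] [] /=; rewrite !in_itv/= => /andP[s1 s2] /andP[t1 t2].
  by apply: eU; split; rewrite /ball/= ltr_norml; apply/andP; split; lra.
do 4 (apply: bigcupT_measurable_rat => ?).
by case: ifP => // _; apply: measurableX; exact: measurable_itv.
Qed.

(** Tonelli asks for measurability with respect to the product of the two Borel structures.
    Superlevel sets are open, and open sets are countable unions of rational boxes. *)
Lemma lsc_measurable_prod (R : realType) (f : R * R -> \bar R) :
  lower_semicontinuous f ->
  measurable_fun setT f.
Proof.
move=> lf; apply: (measurability _ (ErealGenOInfty.measurableE R)).
move=> /= _ [_ [a ->]] <-; apply: measurableI => //.
apply: open_measurable_prod; rewrite preimage_itvoy.
by move/lower_semicontinuousP : lf; exact.
Qed.

Section shift.
Context {R : realType}.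
Local Notation mu := lebesgue_measure.
Local Open Scope ereal_scope.

(** By uniqueness of Lebesgue measure, only lengths of half-open intervals have to be compared. *)
Lemma lebesgue_measure_shift (c : R) (A : set R) : measurable A ->
  pushforward mu (fun x : R => x + c : measurableTypeR R)%R A = mu A.
Proof.
move=> mA.
have mc : measurable_fun setT (fun x : measurableTypeR R => x + c : measurableTypeR R)%R.
  by apply: measurable_funD => //; exact: measurable_cst.
pose mc' := isMeasurableFun.Build _ _ _ _ _ mc.
pose g : {mfun _ >-> _} := HB.pack
  (fun x : measurableTypeR R => x + c : measurableTypeR R)%R mc'.
apply/esym/(@lebesgue_measure_unique R (pushforward mu g)) => //.
move=> _ [[a b]] _ <-.
change (mu `]a, b]%classic = mu (g @^-1` `]a, b]%classic)).
have -> : g @^-1` `]a, b]%classic = [set` `](a - c)%R, (b - c)%R]%R].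
  by apply/seteqP; split => x /=; rewrite !in_itv/= ltrBlDr lerBrDr.
etransitivity; first exact: lebesgue_measure_itv.
etransitivity; last by apply/esym; exact: lebesgue_measure_itv.
rewrite /= !lte_fin ltrD2r.
by case: ifP => // _; rewrite -!EFinB; congr (_%:E); ring.
Qed.

Lemma ge0_integral_shift (c : R) (D : set R) (f : R -> \bar R) :
  measurable D -> measurable_fun setT f -> (forall r, 0 <= f r) ->
  \int[mu]_(x in D) f x = \int[mu]_(x in [set x | D (x + c)%R]) f (x + c)%R.
Proof.
move=> mD mf f0.
have mc : measurable_fun setT (fun x : measurableTypeR R => x + c : measurableTypeR R)%R.
  by apply: measurable_funD => //; exact: measurable_cst.
rewrite -(@ge0_integral_pushforward _ _ _ _ _ _ mc)//; last exact: measurable_funS mf.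
by apply: eq_measure_integral => //= A mA AS; exact/esym/lebesgue_measure_shift.
Qed.

Lemma ge0_integral_split (a b c : R) (f : R -> \bar R) : (a <= b <= c)%R ->
  measurable_fun setT f -> (forall r, 0 <= f r) ->
  \int[mu]_(x in `[a, c]) f x =
  \int[mu]_(x in `[a, b]) f x + \int[mu]_(x in `[b, c]) f x.
Proof.
move=> /andP[ab bc] mf f0.
have mf' (D : set R) : measurable D -> measurable_fun D f.
  by move=> mD; exact: measurable_funS mf.
rewrite -[X in _ = X + _]integral_itv_bndo_bndc; last exact: mf'.
rewrite -ge0_integral_setU//=.
- congr (integral _ _ _); apply/seteqP; split => x /=; rewrite !in_itv/=.
    by move=> /andP[ax xc]; case: (ltP x b) => xb; [left|right]; apply/andP.
  by move=> [|] /andP[? ?]; apply/andP; split => //; lra.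
- by apply: mf'; exact: measurableU.
- rewrite disj_set2E; apply/eqP/seteqP; split => x //=.
  by rewrite !in_itv/= => -[/andP[_ xb] /andP[bx _]]; move: xb; rewrite ltNge bx.
Qed.

(** The shift moves the interval to [[th, T + th]]. Compared with [[0, T]], the part [[th, T]] is
    common, and the leftovers [[T, T + th]] and [[0, th]] correspond under the period. *)
Lemma ge0_integral_periodic (f : R -> \bar R) (T th : R) :
  (0 <= th <= T)%R -> measurable_fun setT f -> (forall r, 0 <= f r) ->
  (forall t, f (t + T)%R = f t) ->
  \int[mu]_(t in `[0%R, T]) f (t + th)%R = \int[mu]_(t in `[0%R, T]) f t.
Proof.
move=> /andP[th0 thT] mf f0 fT.
have -> : \int[mu]_(t in `[0%R, T]) f (t + th)%R =
    \int[mu]_(t in `[th, (T + th)%R]) f t.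
  rewrite [RHS](ge0_integral_shift th)//; congr (integral _ _ _).
  by apply/seteqP; split => x /=; rewrite !in_itv/= lerDr lerD2r.
rewrite (@ge0_integral_split th T (T + th)%R)//; last first.
  by apply/andP; split; lra.
rewrite [RHS](@ge0_integral_split 0%R th T) ?th0// addeC; congr (_ + _).
rewrite [LHS](ge0_integral_shift T)//; under eq_integral do rewrite fT.
congr (integral _ _ _).
by apply/seteqP; split => x /=; rewrite !in_itv/= [(T + th)%R]addrC lerD2r lerDr.
Qed.

Lemma ge0_tonelli (D E : set R) (f : R * R -> \bar R) :
  measurable D -> measurable E ->
  measurable_fun setT f ->
  (forall z, 0 <= f z) ->
  \int[mu]_(x in D) \int[mu]_(y in E) f (x, y) =
  \int[mu]_(y in E) \int[mu]_(x in D) f (x, y).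
Proof.
move=> mD mE mf f0.
have mDE : measurable (D `*` E : set (measurableTypeR R * measurableTypeR R)).
  exact: measurableX.
pose g := f \_ (D `*` E).
have mg : measurable_fun setT g.
  by apply/(measurable_restrictT _ _).1 => //; exact: measurable_funS mf.
have g0 z : 0 <= g z by apply: erestrict_ge0.
have := @fubini_tonelli _ _ _ _ R mu mu g mg g0.
congr (_ = _).
- rewrite [RHS]integral_mkcond; apply: eq_integral => x _; rewrite /patch.
  case: ifPn => xD; last first.
    apply: integral0_eq => y _; rewrite /g /patch ifF//.
    by apply/negbTE; rewrite in_setX/= (negbTE xD).
  rewrite [RHS]integral_mkcond; apply: eq_integral => y _.
  by rewrite /g /patch in_setX/= xD.
- rewrite [RHS]integral_mkcond; apply: eq_integral => x _; rewrite /patch.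
  case: ifPn => xD; last first.
    apply: integral0_eq => y _; rewrite /g /patch ifF//.
    by apply/negbTE; rewrite in_setX/= (negbTE xD) andbF.
  rewrite [RHS]integral_mkcond; apply: eq_integral => y _.
  by rewrite /g /patch in_setX/= xD andbT.
Qed.
End shift.

(** * Semicontinuity *)

Lemma lt_ereal_between (R : realType) (x y : \bar R) :
  (x < y)%E -> exists a : R, (x < a%:E)%E /\ (a%:E < y)%E.
Proof.
case: x y => [x| |] [y| |] //=.
- by rewrite lte_fin => xy; exists ((x + y) / 2); rewrite !lte_fin; lra.
- by move=> _; exists (x + 1); rewrite lte_fin ltry; split=> //; lra.
- by move=> _; exists (y - 1); rewrite lte_fin ltNyr; split=> //; lra.
- by move=> _; exists 0; rewrite ltry ltNyr.
Qed.

Lemma lee_lt_real (R : realType) (x y : \bar R) :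
  (forall a : R, (a%:E < x)%E -> (a%:E <= y)%E) -> (x <= y)%E.
Proof.
move=> h; rewrite leNgt; apply/negP => /lt_ereal_between[a [ya ax]].
by have := h a ax; rewrite leNgt ya.
Qed.

Lemma limn_einf_ge (R : realType) (u : (\bar R)^nat) (l : \bar R) :
  (forall a : R, (a%:E < l)%E -> \forall n \near \oo, (a%:E < u n)%E) ->
  (l <= limn_einf u)%E.
Proof.
move=> h; apply: lee_lt_real => a /h ha.
rewrite [limn_einf u](_ : _ = limf_einf u \oo)// limf_einfE; apply: le_ereal_sup_tmp => /=.
exists (ereal_inf [set u n | n in [set n | (a%:E < u n)%E]]).
  by exists [set n | (a%:E < u n)%E].
by apply: le_ereal_inf_tmp => _ [n /= an <-]; exact: ltW.
Qed.

Lemma limn_einf_le (R : realType) (u : (\bar R)^nat) (l : \bar R) :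
  (forall n, (u n <= l)%E) -> (limn_einf u <= l)%E.
Proof.
move=> h; rewrite [limn_einf u](_ : _ = limf_einf u \oo)// limf_einfE; apply: ge_ereal_sup => _ [V FV <-].
have [n Vn] := filter_ex FV.
by apply: ge_ereal_inf; exists (u n) => //; exists n.
Qed.

Definition lsc_on (T : topologicalType) (R : realType) (D : set T)
    (f : T -> \bar R) : Prop :=
  forall x, D x -> forall a : R, (a%:E < f x)%E ->
    \forall y \near within D (nbhs x), (a%:E < f y)%E.

Lemma lsc_on_comp (S T : topologicalType) (R : realType) (D : set T)
    (f : T -> \bar R) (phi : S -> T) :
  lsc_on D f -> continuous phi -> (forall s, D (phi s)) ->
  lower_semicontinuous (f \o phi).
Proof.
move=> lf cphi Dphi s a /= /(lf _ (Dphi s)); rewrite near_withinE => /cphi /= h.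
by exists (phi @^-1` [set y | D y -> (a%:E < f y)%E]) => // t /= /(_ (Dphi t)).
Qed.

(** The sets of points of [A] where [f] is at most [f y] are nonempty and nested, so they generate a
    proper filter. Semicontinuity keeps its cluster points in all of them. *)
Lemma lsc_on_min (T : topologicalType) (R : realType) (A : set T)
    (f : T -> \bar R) : compact A -> A !=set0 -> lsc_on A f ->
  exists2 x, A x & forall y, A y -> (f x <= f y)%E.
Proof.
move=> cA [x0 Ax0] lf.
pose F := filter_from A (fun y => A `&` [set x | (f x <= f y)%E]).
have FF : ProperFilter F.
  apply: filter_from_proper; last by move=> y Ay; exists y; split => //=.
  apply: filter_from_filter; first by exists x0.
  move=> y z Ay Az; have [yz|zy] := leP (f y) (f z).
    exists y => // x [Ax /= xy]; split; split => //=; exact: le_trans yz.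
  by exists z => // x [Ax /= xz]; split; split => //=; exact: le_trans (ltW zy).
have FA : F A by exists x0 => // x [].
have [x [Ax clx]] := cA F FF FA; exists x => // y Ay.
rewrite leNgt; apply/negP => /lt_ereal_between[a [ya ax]].
have Fy : F (A `&` [set x | (f x <= f y)%E]) by exists y.
have /= := lf x Ax a ax; rewrite near_withinE => h.
have [z [[Az /= zy] /= /(_ Az)]] := clx _ _ Fy h.
by rewrite ltNge (le_trans zy (ltW ya)).
Qed.

Lemma usc_on_max (T : topologicalType) (R : realType) (A : set T)
    (f : T -> \bar R) : compact A -> A !=set0 -> usc_on A f ->
  exists2 x, A x & forall y, A y -> (f y <= f x)%E.
Proof.
move=> cA A0 uf.
have [|x Ax h] := @lsc_on_min T R A (fun x => - f x)%E cA A0.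
  move=> x Ax a; rewrite lteNr => /(uf x Ax).
  by apply: filterS => y; rewrite lteNr.
by exists x => // y Ay; rewrite -leeN2 h.
Qed.

(** [acos] yields the angle when [y >= 0]; the reflected angle [2 * pi - acos c] serves [y < 0], and
    any angle does at the origin. *)
Lemma polar_coordinates (R : realType) (x y : R) : exists2 phi : R, 0 <= phi <= 2 * pi &
  x = Num.sqrt (x ^+ 2 + y ^+ 2) * cos phi /\
  y = Num.sqrt (x ^+ 2 + y ^+ 2) * sin phi.
Proof.
set s := Num.sqrt _.
have xy0 : 0 <= x ^+ 2 + y ^+ 2 by rewrite addr_ge0 ?sqr_ge0.
have s2 : s ^+ 2 = x ^+ 2 + y ^+ 2 by rewrite sqr_sqrtr.
have := pi_gt0 R => pi0.
have [s0|s0] := eqVneq s 0.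
  exists 0; first by lra.
  move: s2; rewrite s0 expr0n/= => /esym/eqP.
  rewrite paddr_eq0 ?sqr_ge0// !sqrf_eq0 => /andP[/eqP -> /eqP ->].
  by rewrite !mul0r.
have sp : 0 < s by rewrite lt_def s0 sqrtr_ge0.
set c := x / s; set d := y / s.
have xc : x = s * c by rewrite /c mulrC divfK.
have yd : y = s * d by rewrite /d mulrC divfK.
have cd : c ^+ 2 + d ^+ 2 = 1.
  by rewrite /c /d !expr_div_n -mulrDl -s2 divff// expf_neq0.
have cB : -1 <= c <= 1.
  by rewrite -ler_norml -(@ler_pXn2r _ 2)// ?nnegrE// expr1n real_normK ?num_real//; nra.
have [/andP[a0 api] ac] := acos_def cB.
have sac : sin (acos c) = `|d|.
  by rewrite sin_acos// -cd addrAC subrr add0r sqrtr_sqr.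
have [d0|d0] := leP 0 d.
  exists (acos c); first by lra.
  by rewrite ac sac ger0_norm.
exists (2 * pi - acos c); first by lra.
have -> : 2 * pi - acos c = - acos c + pi *+ 2 by rewrite mulr2n; ring.
by rewrite cosD2pi sinD2pi cosN sinN ac sac ltr0_norm// opprK.
Qed.

(** * Circle averages *)

Definition circle_pt (R : realType) (z : R * R) (r t : R) : R * R :=
  (z.1 + r * cos t, z.2 + r * sin t).

Section continuous_arith.
Context {T : topologicalType} {R : realType}.
Implicit Types f g : T -> R.

Lemma continuous_fun_cst (c : R) : continuous (fun _ : T => c).
Proof. by move=> t; exact: cvg_cst. Qed.

Lemma continuous_funD f g : continuous f -> continuous g -> continuous (fun t => f t + g t).
Proof. by move=> cf cg t; apply: cvgD; [exact: cf|exact: cg]. Qed.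

Lemma continuous_funB f g : continuous f -> continuous g -> continuous (fun t => f t - g t).
Proof. by move=> cf cg t; apply: cvgB; [exact: cf|exact: cg]. Qed.

Lemma continuous_funM f g : continuous f -> continuous g -> continuous (fun t => f t * g t).
Proof. by move=> cf cg t; apply: cvgM; [exact: cf|exact: cg]. Qed.

Lemma continuous_fun_comp f (h : R -> R) : continuous f -> continuous h ->
  continuous (fun t => h (f t)).
Proof. by move=> cf ch t; apply: continuous_comp; [exact: cf|exact: ch]. Qed.

Lemma continuous_pair f g : continuous f -> continuous g ->
  continuous (fun t => (f t, g t) : R * R).
Proof. by move=> cf cg t; exact: (cvg_pair (cf t) (cg t)). Qed.

End continuous_arith.

Lemma continuous_proj1 (R : realType) : continuous (fun w : R * R => w.1).
Proof. by move=> w; exact: cvg_fst. Qed.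

Lemma continuous_proj2 (R : realType) : continuous (fun w : R * R => w.2).
Proof. by move=> w; exact: cvg_snd. Qed.

Lemma continuous_circle_pt (R : realType) (z : R * R) (r : R) :
  continuous (circle_pt z r).
Proof.
apply: continuous_pair; apply: continuous_funD; try exact: continuous_fun_cst; apply: continuous_funM;
  [exact: continuous_fun_cst|exact: continuous_cos|exact: continuous_fun_cst|exact: continuous_sin].
Qed.

Lemma circle_pt_in (R : realType) (z : R * R) (r s t : R) : 0 <= s <= r ->
  closed_disc z r (circle_pt z s t).
Proof.
move=> /andP[s0 sr]; rewrite /closed_disc/circle_pt/=.
rewrite ![_ + _ - _]addrAC !subrr !add0r !exprMn -mulrDr cos2Dsin2 mulr1.
by rewrite ler_pXn2r// nnegrE// (le_trans s0).
Qed.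

Lemma closed_disc_compact (R : realType) (z : R * R) (r : R) :
  compact (closed_disc z r).
Proof.
apply: (@subclosed_compact _ _
  (`[z.1 - `|r|, z.1 + `|r|]%classic `*` `[z.2 - `|r|, z.2 + `|r|]%classic)).
- apply: (@closed_comp _ _ (fun w : R * R => (w.1 - z.1) ^+ 2 + (w.2 - z.2) ^+ 2)
    [set x | x <= r ^+ 2]); last exact: closed_le.
  move=> w _; move: w; apply: continuous_funD; apply: continuous_funM; apply: continuous_funB;
    by [exact: continuous_proj1|exact: continuous_proj2|exact: continuous_fun_cst].
- by apply: compact_setX; exact: segment_compact.
- move=> w; rewrite /closed_disc /= !in_itv/= -!ler_distl => h.
  split; rewrite -(@ler_pXn2r _ 2)// ?nnegrE// !real_normK ?num_real//.
    by rewrite (le_trans _ h)// lerDl sqr_ge0.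
  by rewrite (le_trans _ h)// lerDr sqr_ge0.
Qed.

Section circle_integral.
Context {R : realType}.
Local Notation mu := lebesgue_measure.
Local Open Scope ereal_scope.

Definition circ : set R := `[0%R, (2 * pi)%R]%classic.

Lemma measurable_circ : measurable circ.
Proof. exact: measurable_itv. Qed.
Hint Resolve measurable_circ : core.

Lemma integral_circ_shift (f : R -> \bar R) (th : R) : (0 <= th <= 2 * pi)%R ->
  measurable_fun setT f -> (forall r, 0 <= f r) ->
  (forall t, f (t + pi *+ 2)%R = f t) ->
  \int[mu]_(t in circ) f (t + th)%R = \int[mu]_(t in circ) f t.
Proof.
by move=> ? ? ? fT; apply: ge0_integral_periodic => // t; rewrite mulr_natl fT.
Qed.

Lemma integral_circle_cst (x : \bar R) :
  \int[mu]_(t in circ) x = (2 * pi)%:E * x.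
Proof.
rewrite integral_cst//= lebesgue_measure_itv/= lte_fin.
by rewrite mulr_gt0 ?pi_gt0// oppr0 adde0 muleC.
Qed.

(** A half-turn exchanges [1 - cos] and [1 + cos], whose sum is the constant 2. The summand 1 keeps
    the integrands nonnegative, as the shift lemma requires. *)
Lemma integral_one_sub_cos :
  \int[mu]_(t in circ) (1 - cos t)%:E =
  (2 * pi : R)%:E.
Proof.
have pi0 := pi_gt0 R.
have c : continuous (fun t : R => 1 - cos t)%R.
  by apply: continuous_funB; [exact: continuous_fun_cst|exact: continuous_cos].
have c' : continuous (fun t : R => 1 + cos t)%R.
  by apply: continuous_funD; [exact: continuous_fun_cst|exact: continuous_cos].
have m : measurable_fun setT (fun t : R => (1 - cos t)%:E).
  by apply/measurable_EFinP; exact: continuous_measurable_fun.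
have m' : measurable_fun setT (fun t : R => (1 + cos t)%:E).
  by apply/measurable_EFinP; exact: continuous_measurable_fun.
have p : forall t : R, 0 <= (1 - cos t)%:E.
  by move=> t; rewrite lee_fin subr_ge0 cos_le1.
have p' : forall t : R, 0 <= (1 + cos t)%:E.
  by move=> t; rewrite lee_fin -lerBlDl sub0r cos_geN1.
have E : \int[mu]_(t in circ) (1 - cos t)%:E =
         \int[mu]_(t in circ) (1 + cos t)%:E.
  have <- // := @integral_circ_shift (fun t => (1 - cos t)%:E) pi.
  - by apply: eq_integral => t _; rewrite cosDpi opprK.
  - by apply/andP; split; lra.
  - by move=> t; rewrite cosD2pi.
have S : \int[mu]_(t in circ) (1 - cos t)%:E +
         \int[mu]_(t in circ) (1 - cos t)%:E = (2 * pi)%:E * 2%:E.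
  rewrite {2}E -ge0_integralD//; try exact: measurable_funTS.
  rewrite -integral_circle_cst; apply: eq_integral => t _.
  by rewrite -EFinD; congr (_%:E); ring.
have : 0 <= \int[mu]_(t in circ) (1 - cos t)%:E by exact: integral_ge0.
move: S; move: (\int[mu]_(t in circ) (1 - cos t)%:E) => x S x0.
by case: x S x0 => [x|//|//] /= [h] _; congr (_%:E); lra.
Qed.

Lemma measurable_circle (D : set (R * R)) (g : R * R -> \bar R) (z : R * R) (r : R) :
  lsc_on D g -> (forall t, D (circle_pt z r t)) ->
  measurable_fun setT (fun t => g (circle_pt z r t)).
Proof.
move=> lg Dz; apply: lower_semicontinuous_measurable.
exact: (lsc_on_comp lg (@continuous_circle_pt _ z r) Dz).
Qed.

Section radial.
Variables (g : R * R -> \bar R) (z0 : R * R) (r : R).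
Hypothesis r0 : (0 < r)%R.
Hypothesis g0 : forall w, 0 <= g w.
Hypothesis lg : lsc_on (closed_disc z0 r) g.

Let m (s : R) := \int[mu]_(t in circ) g (circle_pt z0 s t).

(** If it failed at [s], some radii [u n] tending to [s] would satisfy [m (u n) <= a < m s]. Fatou
    along this sequence, with lower semicontinuity of [g] at each point of the circle of radius [s],
    contradicts that. *)
Lemma radial_lsc : lsc_on `[0%R, r]%classic m.
Proof.
move=> s /[dup] sr; rewrite /= in_itv/= => /andP[s0 sr'] a am.
rewrite near_withinE; apply: contrapT => H.
have : forall n : nat, exists t : R, [/\ (0 <= t <= r)%R,
    (`|s - t| < n.+1%:R^-1)%R & m t <= a%:E].
  move=> n; apply: contrapT => K; apply: H.
  have : nbhs s (ball s n.+1%:R^-1) by apply: nbhsx_ballx; rewrite invr_gt0.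
  apply: filterS => t st; rewrite /= in_itv/= => tr.
  by rewrite ltNge; apply/negP => mt; apply: K; exists t; split.
move=> /choice[u hu].
have us : u @ \oo --> s.
  apply/cvgrPdist_lt => e e0; have [N _ hN] := near_infty_natSinv_lt (PosNum e0).
  by exists N => // n /hN; apply: lt_trans; have [] := hu n.
have : m s <= a%:E; last by rewrite leNgt am.
apply: (@le_trans _ _ (\int[mu]_(t in circ)
    limn_einf (fun n => g (circle_pt z0 (u n) t)))).
  apply: ge0_le_integral => //.
  - apply: measurable_funTS; apply: (measurable_circle lg) => t.
    by apply: circle_pt_in; rewrite s0.
  - rewrite /limn_einf; apply: measurableT_comp => //.
    apply: (measurable_fun_limn_esup (f := fun n t => - g (circle_pt z0 (u n) t))) => n.
    apply: measurableT_comp => //; apply: measurable_funTS; apply: (measurable_circle lg) => t.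
    by apply: circle_pt_in; have [] := hu n.
  - move=> t _; apply: limn_einf_ge => b bg.
    have Ds : closed_disc z0 r (circle_pt z0 s t) by apply: circle_pt_in; rewrite s0.
    have := lg Ds bg; rewrite near_withinE => h.
    have ct : (fun n => circle_pt z0 (u n) t) @ \oo --> circle_pt z0 s t.
      have c : continuous (fun x => circle_pt z0 x t).
        by apply: continuous_pair; apply: continuous_funD; try exact: continuous_fun_cst;
          apply: continuous_funM; try exact: continuous_fun_cst; move=> ?; exact: cvg_id.
      exact: (cvg_comp _ _ us (c s)).
    have [N _ hN] := ct _ h; exists N => // n /hN /=; apply.
    by apply: circle_pt_in; have [] := hu n.
have mu_n n : measurable_fun circ (fun t => g (circle_pt z0 (u n) t)).
  apply: measurable_funTS; apply: (measurable_circle lg) => t.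
  by apply: circle_pt_in; have [] := hu n.
apply: (le_trans (@fatou _ _ R mu circ measurable_circ _ mu_n _)) => //.
by apply: limn_einf_le => n; have [] := hu n.
Qed.

(* [m] satisfies the super-mean inequality at [z0 + (s, 0)]: average the
   inequalities at the points of the circle of radius [s]. *)
Lemma radial_supermean (s e : R) : (0 <= s)%R -> (0 < e)%R -> (s + e <= r)%R ->
  (forall t, \int[mu]_(x in circ) g (circle_pt (circle_pt z0 s t) e x)
     <= (2 * pi)%:E * g (circle_pt z0 s t)) ->
  let sigma t := Num.sqrt ((s + e * cos t) ^+ 2 + (e * sin t) ^+ 2) in
  measurable_fun setT (m \o sigma) /\
  \int[mu]_(t in circ) m (sigma t) <= (2 * pi)%:E * m s.
Proof.
move=> s0 e0 ser sup sigma.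
have pi0 := pi_gt0 R.
(* In complex notation [Phi (th, t)] is [z0 + exp(i th) (s + e exp(i t))]. For fixed [t] it runs
   through the circle of radius [sigma t] about [z0]; for fixed [th], through the circle of radius
   [e] about the point of angle [th] on the circle of radius [s]. *)
pose Phi (w : R * R) : R * R :=
  (z0.1 + (s + e * cos w.2) * cos w.1 - e * sin w.2 * sin w.1,
   z0.2 + (s + e * cos w.2) * sin w.1 + e * sin w.2 * cos w.1)%R.
have sigma_r t : (0 <= sigma t <= r)%R.
  rewrite sqrtr_ge0/= -(ger0_norm (ltW r0)) -sqrtr_sqr; apply: ler_wsqrtr.
  have := cos2Dsin2 t; have := cos_le1 t; set c := cos t; set d := sin t => c1 cd.
  have -> : ((s + e * c) ^+ 2 + (e * d) ^+ 2 = s ^+ 2 + 2 * s * e * c + e ^+ 2)%R.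
    by transitivity (s ^+ 2 + 2 * s * e * c + e ^+ 2 * (c ^+ 2 + d ^+ 2))%R;
      [ring|rewrite cd mulr1].
  have : (2 * s * e * c <= 2 * s * e * 1)%R by apply: ler_wpM2l => //; nra.
  nra.
have PhiE t : exists2 phi, (0 <= phi <= 2 * pi)%R &
    forall th, Phi (th, t) = circle_pt z0 (sigma t) (th + phi)%R.
  have [phi phiB [xE yE]] := polar_coordinates (s + e * cos t)%R (e * sin t)%R.
  rewrite -/(sigma t) in xE yE.
  exists phi => // th; rewrite /Phi/circle_pt/= cosD sinD.
  by congr pair; rewrite xE yE; ring.
have DPhi w : closed_disc z0 r (Phi w).
  by case: w => th t; have [phi _ ->] := PhiE t; exact: circle_pt_in.
have cPhi : continuous Phi.
  have [cf cs] := (@continuous_proj1 R, @continuous_proj2 R).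
  have [cc1 cs1] := (continuous_fun_comp cf (@continuous_cos R), continuous_fun_comp cf (@continuous_sin R)).
  have [cc2 cs2] := (continuous_fun_comp cs (@continuous_cos R), continuous_fun_comp cs (@continuous_sin R)).
  have k (c : R) := @continuous_fun_cst (R * R)%type R c.
  apply: continuous_pair.
    exact: (continuous_funB (continuous_funD (k _) (continuous_funM (continuous_funD (k _) (continuous_funM (k _) cc2)) cc1))
                 (continuous_funM (continuous_funM (k _) cs2) cs1)).
  exact: (continuous_funD (continuous_funD (k _) (continuous_funM (continuous_funD (k _) (continuous_funM (k _) cc2)) cs1))
               (continuous_funM (continuous_funM (k _) cs2) cc1)).
have lPhi := lsc_on_comp lg cPhi DPhi.
have mPhi := lsc_measurable_prod lPhi.
have gP z s' : (forall t, closed_disc z0 r (circle_pt z s' t)) ->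
    measurable_fun setT (fun t => g (circle_pt z s' t)).
  exact: measurable_circle.
have Tper z s' t : g (circle_pt z s' (t + pi *+ 2)) = g (circle_pt z s' t).
  by rewrite /circle_pt cosD2pi sinD2pi.
have mE t : m (sigma t) = \int[mu]_(th in circ) (g \o Phi) (th, t).
  have [phi phiB PE] := PhiE t; rewrite /m.
  have <- // := @integral_circ_shift (fun th => g (circle_pt z0 (sigma t) th)) phi; last by apply: gP => th; exact: circle_pt_in.
  by apply: eq_integral => th _; rewrite /= PE.
have PhiE' th t : Phi (th, t) = circle_pt (circle_pt z0 s th) e (t + th)%R.
  by rewrite /Phi/circle_pt/= cosD sinD; congr pair; ring.
split.
  rewrite [m \o sigma](_ : _ = fun t => \int[mu]_th
     ((g \o Phi) \_ (circ `*` setT)) (th, t)); last first.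
    apply/funext => t; rewrite /= mE integral_mkcond; apply: eq_integral => th _.
    by rewrite /patch in_setX/= in_setT andbT.
  apply: (@measurable_fun_fubini_tonelli_G _ _ _ _ _ mu
     ((g \o Phi) \_ (circ `*` setT))).
    apply/(measurable_restrictT _ _).1; last exact: measurable_funTS.
    by apply: measurableX.
  by move=> w; apply: erestrict_ge0 => ? _; exact: g0.
under eq_integral do rewrite mE.
(* After the exchange the inner integral is, up to a rotation by [th], the one bounded by
   [sup th]. *)
rewrite -(@ge0_tonelli _ _ _ (g \o Phi))//; last by move=> w; exact: g0.
have mcs : measurable_fun setT (fun t => g (circle_pt z0 s t)).
  by apply: gP => t; apply: circle_pt_in; rewrite s0/=; lra.
rewrite -ge0_integralZl//; last 2 first.
- exact: measurable_funTS.
- by rewrite lee_fin mulr_ge0// pi_ge0.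
apply: ge0_le_integral => //.
- by move=> th _; apply: integral_ge0 => t _; exact: g0.
- apply: measurable_funTS.
  rewrite [X in measurable_fun _ X](_ : _ = fun th => \int[mu]_t
     ((g \o Phi) \_ (setT `*` circ)) (th, t)); last first.
    apply/funext => th; rewrite integral_mkcond; apply: eq_integral => t _.
    by rewrite /patch in_setX/= in_setT.
  apply: (@measurable_fun_fubini_tonelli_F _ _ _ _ _ mu
     ((g \o Phi) \_ (setT `*` circ))).
    apply/(measurable_restrictT _ _).1; last exact: measurable_funTS.
    by apply: measurableX.
  by move=> w; apply: erestrict_ge0 => ? _; exact: g0.
- by apply: measurable_funTS; exact: measurable_funeM.
move=> th; rewrite /circ/= in_itv/= => thB.
apply: le_trans (sup th).
have <- // := @integral_circ_shift
   (fun t => g (circle_pt (circle_pt z0 s th) e t)) th.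
  rewrite le_eqVlt; apply/orP; left; apply/eqP.
  by apply: eq_integral => t _; rewrite PhiE'.
apply: gP => t; have -> : t = (t - th + th)%R by rewrite subrK.
by rewrite -PhiE'; exact: DPhi.
Qed.

End radial.
End circle_integral.

(** * The super-mean inequality is local *)

#[local] Hint Extern 0 (measurable (@circ _)) => exact: measurable_circ : core.

Section submean.
Context {R : realType}.
Local Notation mu := lebesgue_measure.
Local Open Scope ereal_scope.

(** The classical proof compares [g] with harmonic functions having prescribed boundary values.
    Averaging over rotations first leaves a function of the radius alone, for which a quadratic
    barrier suffices and no Dirichlet problem has to be solved. *)
Lemma supermean_local_global (g : R * R -> \bar R) (z0 : R * R) (r : R) :
  (0 < r)%R -> (forall w, 0 <= g w) -> lsc_on (closed_disc z0 r) g ->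
  (forall w, closed_disc z0 r w -> \forall y \near w & e \near 0%R^'+,
    closed_disc y e `<=` closed_disc z0 r ->
    \int[mu]_(t in circ) g (circle_pt y e t) <= (2 * pi)%:E * g y) ->
  \int[mu]_(t in circ) g (circle_pt z0 r t) <= (2 * pi)%:E * g z0.
Proof.
move=> r0 g0 lg loc.
pose m (s : R) := \int[mu]_(t in circ) g (circle_pt z0 s t).
have m0 : m 0%R = (2 * pi)%:E * g z0.
  rewrite /m -integral_circle_cst; apply: eq_integral => t _.
  by rewrite /circle_pt !mul0r !addr0 -surjective_pairing.
have m_ge0 s : 0 <= m s by exact: integral_ge0.
rewrite -m0 -/(m r).
have [m0oo|m0fin] := eqVneq (m 0%R) +oo; first by rewrite m0oo leey.
have m0f : m 0%R \is a fin_num by rewrite ge0_fin_numE// ltey.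
rewrite leNgt; apply/negP => mr.
have [b [bl br]] := lt_ereal_between mr.
have b0 : (fine (m 0) < b)%R by rewrite -lte_fin fineK.
(* With this [K] the perturbation takes the value [b] at radius 0, strictly below its value [m r] at
   radius [r]. *)
pose K := ((b - fine (m 0%R)) / r ^+ 2)%R.
have K0 : (0 < K)%R by rewrite divr_gt0 ?subr_gt0// exprn_gt0.
have KE : (K * r ^+ 2 = b - fine (m 0))%R by rewrite /K divfK// gt_eqF// exprn_gt0.
(* The strictly super-mean perturbation [m s + K (r^2 - s^2)] cannot attain its
   minimum at an interior radius, yet it is smaller at [0] than at [r]. *)
pose f s := m s + (K * (r ^+ 2 - s ^+ 2))%:E.
have lf : lsc_on `[0%R, r]%classic f.
  move=> s sr a; rewrite /f -lteBlDr// => /lt_ereal_between[a1 [aa1 a1m]].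
  have := radial_lsc g0 lg sr a1m; rewrite !near_withinE => h1.
  have h2 : \forall t \near (s : R), (a - K * (r ^+ 2 - t ^+ 2) < a1)%R.
    have c : continuous (fun t : R => a - K * (r ^+ 2 - t ^+ 2))%R.
      apply: continuous_funB; first exact: continuous_fun_cst.
      apply: continuous_funM; first exact: continuous_fun_cst.
      by apply: continuous_funB; [exact: continuous_fun_cst|exact: exprn_continuous].
    by apply: (cvgr_lt _ (c s)); rewrite -lte_fin EFinB.
  near=> t => tr; rewrite -lteBlDr//.
  apply: (@lt_trans _ _ a1%:E); first by rewrite -EFinB lte_fin; near: t.
  by move: tr; near: t.
have [s sr smin] : exists2 s, `[0%R, r]%classic s &
    forall t, `[0%R, r]%classic t -> f s <= f t.
  apply: lsc_on_min lf; first exact: segment_compact.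
  by exists 0%R; rewrite /= in_itv/= lexx ltW.
have f0r : f 0%R < f r.
  rewrite /f subrr mulr0 adde0 expr0n/= subr0 KE.
  by rewrite -[m 0%R in ltLHS]fineK// -EFinD addrC subrK.
have r_in : `[0%R, r]%classic r by rewrite /= in_itv/= lexx ltW.
have z_in : `[0%R, r]%classic 0%R by rewrite /= in_itv/= lexx ltW.
move: (sr); rewrite /= in_itv/= => /andP[s0 s_r].
have {s_r} s_r : (s < r)%R.
  rewrite lt_neqAle s_r andbT; apply/eqP => sE.
  by have := smin _ z_in; rewrite sE leNgt f0r.
have msf : m s \is a fin_num.
  rewrite ge0_fin_numE// ltey; apply/eqP => ms.
  have := smin _ z_in; rewrite {1}/f ms /= leye_eq /f => /eqP.
  by rewrite -(fineK m0f) -EFinD.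
(* Compactness of the disc makes the locally admissible radii uniform: one [e] serves all centres on
   the circle of radius [s]. *)
have hloc := (compact_near_coveringP _).1 (@closed_disc_compact R z0 r) _ _
  (fun e y => closed_disc y e `<=` closed_disc z0 r ->
    \int[mu]_(t in circ) g (circle_pt y e t) <= (2 * pi)%:E * g y) _ loc.
have : \forall e \near 0%R^'+, (0 < e < r - s)%R /\
    closed_disc z0 r `<=` (fun y => closed_disc y e `<=` closed_disc z0 r ->
    \int[mu]_(t in circ) g (circle_pt y e t) <= (2 * pi)%:E * g y).
  near=> e; split.
    apply/andP; split; first by near: e; exact: nbhs_right_gt.
    by near: e; apply: nbhs_right_lt; rewrite subr_gt0.
  by near: e; exact: hloc.
move=> /filter_ex[e [/andP[e0 ers] he]].
pose sigma (t : R) := Num.sqrt ((s + e * cos t) ^+ 2 + (e * sin t) ^+ 2)%R.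
have [msigma lesigma] : measurable_fun setT (m \o sigma) /\
    \int[mu]_(t in circ) m (sigma t) <= (2 * pi)%:E * m s.
  apply: (@radial_supermean R g z0 r r0 g0 lg s e s0 e0); first by lra.
  move=> t; apply: he; first by apply: circle_pt_in; rewrite s0 ltW.
  move=> w; rewrite /closed_disc /circle_pt/= => we.
  have [th _ [xE yE]] := polar_coordinates (w.1 - (z0.1 + s * cos t))%R (w.2 - (z0.2 + s * sin t))%R.
  set k := Num.sqrt _ in xE yE.
  have k0 : (0 <= k)%R by exact: sqrtr_ge0.
  have ke : (k <= e)%R.
    by rewrite -(ger0_norm (ltW e0)) -sqrtr_sqr; exact: ler_wsqrtr.
  have -> : (w.1 - z0.1 = s * cos t + k * cos th)%R by rewrite -xE; ring.
  have -> : (w.2 - z0.2 = s * sin t + k * sin th)%R by rewrite -yE; ring.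
  have -> : ((s * cos t + k * cos th) ^+ 2 + (s * sin t + k * sin th) ^+ 2 =
      s ^+ 2 + k ^+ 2 + 2 * s * k * cos (t - th))%R.
    rewrite cosB; transitivity (s ^+ 2 * (cos t ^+ 2 + sin t ^+ 2) +
      k ^+ 2 * (cos th ^+ 2 + sin th ^+ 2) +
      2 * s * k * (cos t * cos th + sin t * sin th))%R; first by ring.
    by rewrite !cos2Dsin2 !mulr1.
  have : (2 * s * k * cos (t - th) <= 2 * s * k * 1)%R.
    by apply: ler_wpM2l; [nra|exact: cos_le1].
  nra.
have sigma2 t : (sigma t ^+ 2 = s ^+ 2 + 2 * s * e * cos t + e ^+ 2)%R.
  rewrite /sigma sqr_sqrtr ?addr_ge0 ?sqr_ge0//.
  transitivity (s ^+ 2 + 2 * s * e * cos t + e ^+ 2 * (cos t ^+ 2 + sin t ^+ 2))%R.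
    by ring.
  by rewrite cos2Dsin2 mulr1.
have sigma_in t : `[0%R, r]%classic (sigma t).
  rewrite /= in_itv/= sqrtr_ge0/= -(ler_pXn2r (ltn0Sn 1)) ?nnegrE ?sqrtr_ge0 ?(ltW r0)//.
  rewrite sigma2.
  have : (2 * s * e * cos t <= 2 * s * e * 1)%R.
    by apply: ler_wpM2l; [nra|exact: cos_le1].
  nra.
have pi0 := pi_gt0 R.
have mc : measurable_fun circ (fun t : R => (2 * K * s * e * (1 - cos t))%:E).
  apply: measurable_funTS; apply/measurable_EFinP.
  apply: continuous_measurable_fun; apply: continuous_funM; first exact: continuous_fun_cst.
  by apply: continuous_funB; [exact: continuous_fun_cst|exact: continuous_cos].
have ksE0 : (0 <= 2 * K * s * e)%R by rewrite (mulr_ge0 (mulr_ge0 (mulr_ge0 _ (ltW K0)) s0) (ltW e0)).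
(* This integrates [f s <= f (sigma t)], where [sigma t ^+ 2] equals
   [s ^+ 2 + 2 * s * e * cos t + e ^+ 2]. Adding [2 * K * s * e * (1 - cos t)] removes the cosine on
   the left and keeps all terms nonnegative. With [lesigma] there remains [K * e ^+ 2 <= 0], which
   is absurd. *)
have key : (2 * pi)%:E * (fine (m s) + K * e ^+ 2 + 2 * K * s * e)%:E <=
    \int[mu]_(t in circ) m (sigma t) + (2 * K * s * e)%:E * (2 * pi)%:E.
  rewrite -integral_circle_cst -integral_one_sub_cos -ge0_integralZl//; last first.
  - apply: measurable_funTS; apply/measurable_EFinP.
    apply: continuous_measurable_fun.
    by apply: continuous_funB; [exact: continuous_fun_cst|exact: continuous_cos].
  rewrite -ge0_integralD//; last 2 first.
  - exact: measurable_funTS.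
  - by move=> t _; rewrite -EFinM lee_fin mulr_ge0// subr_ge0 cos_le1.
  apply: ge0_le_integral => //.
  - move=> t _; rewrite lee_fin !addr_ge0 ?fine_ge0// mulr_ge0// ?sqr_ge0// ltW//.
  - by apply: emeasurable_funD => //; exact: measurable_funTS.
  - move=> t _; rewrite -EFinM -leeBlDr//.
    have := smin _ (sigma_in t).
    rewrite /f -leeBlDr// => /(le_trans _); apply.
    rewrite -[m s]fineK// -!EFinD lee_fin sigma2.
    by rewrite le_eqVlt; apply/orP; left; apply/eqP; ring.
have := le_trans key (leeD2r _ lesigma).
rewrite -[m s]fineK// -!EFinM -EFinD lee_fin /=.
have Ke : (0 < K * e ^+ 2)%R by rewrite mulr_gt0// exprn_gt0.
nra.
Unshelve. all: by end_near. Qed.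

(** An upper bound makes the integral of the positive part finite. So either [M - h] is integrable
    and linearity applies, or the negative part has infinite integral and both sides are [-oo]. *)
Lemma integral_circ_sub (h : R -> \bar R) (M : R) : measurable_fun circ h ->
  (forall t, circ t -> h t <= M%:E) ->
  \int[mu]_(t in circ) h t =
  (2 * pi * M)%:E - \int[mu]_(t in circ) (M%:E - h t).
Proof.
move=> mh hM.
have mg : measurable_fun circ (fun t => M%:E - h t).
  by apply: emeasurable_funB => //; exact: measurable_cst.
have g0 t : circ t -> 0 <= M%:E - h t by move=> /hM; rewrite sube_ge0// orbT.
have icst (x : R) : mu.-integrable circ (fun=> x%:E).
  apply/integrableP; split; first exact: measurable_cst.
  by rewrite /= integral_circle_cst -EFinM ltry.
have [goo|gfin] := eqVneq (\int[mu]_(t in circ) (M%:E - h t)) +oo; last first.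
  have ig : mu.-integrable circ (fun t => M%:E - h t).
    apply/integrableP; split => //.
    apply: (@le_lt_trans _ _ (\int[mu]_(t in circ) (M%:E - h t))).
      rewrite le_eqVlt; apply/orP; left; apply/eqP; apply: eq_integral => t /[!inE] tc.
      by rewrite gee0_abs// g0.
    by rewrite ltey.
  rewrite EFinM -integral_circle_cst -integralB//.
  apply: eq_integral => t /[!inE] tc; have := hM _ tc.
  by case: (h t) => //= x _; rewrite -!EFinB; congr (_%:E); ring.
rewrite goo /= addeNy integralE.
have hp : \int[mu]_(t in circ) (h^\+ t) < +oo.
  have : \int[mu]_(t in circ) (h^\+ t) <= \int[mu]_(t in circ) `|M|%:E.
    apply: ge0_le_integral => //; first exact: measurable_funepos.
    move=> t tc; rewrite funeposE ge_max lee_fin normr_ge0 andbT.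
    by rewrite (le_trans (hM _ tc))// lee_fin ler_norm.
  by move=> /le_lt_trans; apply; rewrite integral_circle_cst -EFinM ltry.
have -> : \int[mu]_(t in circ) (h^\- t) = +oo.
  apply/eqP; rewrite -leye_eq -goo.
  have hm : \int[mu]_(t in circ) (M%:E - h t) <=
      \int[mu]_(t in circ) (`|M|%:E + h^\- t).
    apply: ge0_le_integral => //.
      by apply: emeasurable_funD => //; exact: measurable_funeneg.
    move=> t tc; rewrite funenegE; apply: leeD.
      by rewrite lee_fin ler_norm.
    by rewrite le_max lexx.
  move: hm; rewrite [leRHS]ge0_integralD//; last exact: measurable_funeneg.
  rewrite integral_circle_cst -EFinM goo.
  by case: (\int[mu]_(t in circ) (h^\- t)).
by rewrite addeNy.
Qed.

(** The passage from submean inequalities to super-mean inequalities of nonnegative functions, valid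
    also when values or integrals are infinite. *)
Lemma le_circle_meanP (h : R -> \bar R) (M : R) (x : \bar R) :
  measurable_fun circ h -> (forall t, circ t -> h t <= M%:E) -> x <= M%:E ->
  (x <= ((2 * pi)^-1)%:E * \int[mu]_(t in circ) h t) =
  (\int[mu]_(t in circ) (M%:E - h t) <= (2 * pi)%:E * (M%:E - x)).
Proof.
move=> mh hM xM; rewrite (integral_circ_sub mh hM).
have pi0 : (0 < 2 * pi :> R)%R by rewrite mulr_gt0 ?pi_gt0.
have : 0 <= \int[mu]_(t in circ) (M%:E - h t).
  by apply: integral_ge0 => t /hM; rewrite sube_ge0// orbT.
case: (\int[mu]_(t in circ) (M%:E - h t)) => [y| |]// _.
- case: x xM => [x| |]// xM.
    rewrite -EFinB -EFinM -EFinB -EFinM !lee_fin mulrC ler_pdivlMr//.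
    by apply/idP/idP; nra.
  by rewrite leNye /= gt0_muley ?lte_fin// leey.
- rewrite /= addeNy gt0_muleNy ?lte_fin ?invr_gt0//.
  by case: x xM => [x| |]// xM; rewrite /= gt0_muley ?lte_fin// !lexx.
Qed.

End submean.

(** * Subharmonic functions in the plane *)

Section planar.
Context {R : realType}.
Local Notation mu := lebesgue_measure.
Local Open Scope ereal_scope.
Implicit Types (D A K : set (R * R)) (u v f : R * R -> \bar R) (z : R * R).

Lemma usc_onS (T : topologicalType) (D E : set T) (f : T -> \bar R) :
  D `<=` E -> usc_on E f -> usc_on D f.
Proof.
move=> DE uf x Dx a /(uf x (DE _ Dx)); rewrite !near_withinE.
by apply: filterS => y h Dy; apply: h; exact: DE.
Qed.

Lemma usc_on_comp (S T : topologicalType) (D : set T) (f : T -> \bar R)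
    (phi : S -> T) : usc_on D f -> continuous phi ->
  usc_on (phi @^-1` D) (f \o phi).
Proof.
by move=> uf cphi x Dx a /(uf _ Dx); rewrite !near_withinE => /(cphi x).
Qed.

Lemma lte_EFinBr (x : \bar R) (M a : R) : (a%:E < M%:E - x) = (x < (M - a)%:E).
Proof.
case: x => [x| |] //=; first by rewrite -EFinB !lte_fin ltrBrDr ltrBrDl.
by rewrite addey ?ltNyr ?ltry.
Qed.

Lemma usc_on_lsc (T : topologicalType) (D : set T) (f : T -> \bar R) (M : R) :
  usc_on D f -> lsc_on D (fun x => M%:E - f x).
Proof.
move=> uf x Dx a; rewrite lte_EFinBr => /(uf x Dx).
by apply: filterS => y; rewrite lte_EFinBr.
Qed.

Lemma measurable_circle_usc D u z (r : R) : usc_on D u ->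
  (forall t, D (circle_pt z r t)) ->
  measurable_fun circ (fun t => u (circle_pt z r t)).
Proof.
move=> uu Dz; apply: measurable_funTS.
have := measurable_circle (usc_on_lsc (M := 0%R) uu) Dz.
set h := (X in measurable_fun _ X) => mh.
have : measurable_fun setT (fun t => - h t) by exact: measurableT_comp.
by apply: eq_measurable_fun => t _; rewrite /h sub0e oppeK.
Qed.

Lemma closed_disc_refl z (r : R) : closed_disc z r z.
Proof. by rewrite /closed_disc/= !subrr expr0n/= addr0 sqr_ge0. Qed.

Lemma disc_circle_pt z (r t : R) : (0 < r)%R -> closed_disc z r (circle_pt z r t).
Proof. by move=> r0; apply: circle_pt_in; rewrite lexx ltW. Qed.

Lemma usc_disc_bound D u z (r : R) : usc_on D u -> (forall w, D w -> u w < +oo) ->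
  closed_disc z r `<=` D ->
  exists M : R, forall w, closed_disc z r w -> u w <= M%:E.
Proof.
move=> uu ufin BD.
have B0 : closed_disc z r !=set0 by exists z; exact: closed_disc_refl.
have [x Bx xmax] := usc_on_max (@closed_disc_compact R z r) B0 (usc_onS BD uu).
have := ufin _ (BD _ Bx); case ux : (u x) => [M| |]// _.
  by exists M => w Bw; rewrite -ux xmax.
by exists 0%R => w Bw; rewrite (le_trans (xmax _ Bw))// ux leNye.
Qed.

Lemma submeanP D u z (r M : R) : (0 < r)%R -> usc_on D u ->
  closed_disc z r `<=` D -> (forall w, closed_disc z r w -> u w <= M%:E) ->
  (u z <= circle_mean u z r) =
  (\int[mu]_(t in circ) (M%:E - u (circle_pt z r t)) <= (2 * pi)%:E * (M%:E - u z)).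
Proof.
move=> r0 uu BD uM; apply: le_circle_meanP.
- by apply: (measurable_circle_usc uu) => t; apply: BD; exact: disc_circle_pt.
- by move=> t _; apply: uM; exact: disc_circle_pt.
- by apply: uM; exact: closed_disc_refl.
Qed.

(** Raising a function without changing its value at the centre can only raise the mean. Maxima are
    handled this way, since at the centre a maximum equals one of its two arguments. *)
Lemma submean_mono D u v z (r : R) : (0 < r)%R -> usc_on D u -> usc_on D v ->
  (forall w, D w -> v w < +oo) -> closed_disc z r `<=` D ->
  (forall w, closed_disc z r w -> u w <= v w) -> u z = v z ->
  u z <= circle_mean u z r -> v z <= circle_mean v z r.
Proof.
move=> r0 uu uv vfin BD uv_le uvz.
have [M vM] := usc_disc_bound uv vfin BD.
have uM w : closed_disc z r w -> u w <= M%:E.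
  by move=> Bw; rewrite (le_trans (uv_le _ Bw))// vM.
rewrite (submeanP r0 uu BD uM) (submeanP r0 uv BD vM) uvz; apply: le_trans.
have mM w : measurable_fun circ (fun t => w (circle_pt z r t)) ->
    measurable_fun circ (fun t => M%:E - w (circle_pt z r t)).
  by move=> ?; apply: emeasurable_funB => //; exact: measurable_cst.
apply: ge0_le_integral => //.
- by move=> t _; rewrite sube_ge0 ?orbT//; apply: vM; exact: disc_circle_pt.
- apply: mM; apply: (measurable_circle_usc uv) => t; apply: BD; exact: disc_circle_pt.
- apply: mM; apply: (measurable_circle_usc uu) => t; apply: BD; exact: disc_circle_pt.
- by move=> t _; apply: leeB => //; apply: uv_le; exact: disc_circle_pt.
Qed.

Lemma near_right_gt0 z : \forall y \near z & e \near (0%R : R)^'+, (0 < e)%R.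
Proof.
exists (setT, [set e : R | 0 < e]%R) => [|[y e] []//].
by split; [exact: filterT|exact: nbhs_right_gt].
Qed.

Lemma near_closed_disc A z : open A -> A z ->
  \forall y \near z & e \near 0%R^'+, closed_disc y e `<=` A.
Proof.
move=> oA Az; have /nbhs_ballP[d /= d0 dA] : nbhs z A by exact: open_nbhs_nbhs.
near=> y e => w yw; apply: dA.
have zy : ball z (d / 2) y by near: y; apply: nbhsx_ballx; rewrite divr_gt0.
have e0 : (0 < e)%R by near: e; exact: nbhs_right_gt.
have ed : (e < d / 2)%R by near: e; apply: nbhs_right_lt; rewrite divr_gt0.
have [zy1 zy2] : (`|z.1 - y.1| < d / 2 /\ `|z.2 - y.2| < d / 2)%R by case: zy.
have sq (a : R) : (a ^+ 2 <= e ^+ 2 -> `|a| <= e)%R.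
  by move=> h; rewrite -(ger0_norm (ltW e0)) -(@ler_pXn2r _ 2)// ?nnegrE// !real_normK ?num_real.
have [w1 w2] : (`|y.1 - w.1| <= e /\ `|y.2 - w.2| <= e)%R.
  move: yw; rewrite /closed_disc/= => yw; rewrite (distrC y.1) (distrC y.2).
  split; apply: sq; apply: le_trans yw; first by rewrite lerDl sqr_ge0.
  by rewrite lerDr sqr_ge0.
move: zy1 zy2 w1 w2; rewrite !ltr_norml !ler_norml.
move=> /andP[? ?] /andP[? ?] /andP[? ?] /andP[? ?].
by split; rewrite /ball/= ltr_norml; apply/andP; split; lra.
Unshelve. all: by end_near. Qed.

Lemma subharmonic_local D u : open D -> usc_on D u -> (forall z, D z -> u z < +oo) ->
  (forall w, D w -> \forall y \near w & e \near 0%R^'+, u y <= circle_mean u y e) ->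
  subharmonic D u.
Proof.
move=> oD uu ufin loc; split=> // z r r0 BD.
have [M uM] := usc_disc_bound uu ufin BD.
rewrite (submeanP r0 uu BD uM).
pose B := closed_disc z r.
(* [M] bounds [u] on [B] only, whereas a function nonnegative on the whole plane is wanted; the
   cut-off is harmless because only discs inside [B] are tested. *)
pose g := (fun w => M%:E - u w) \_ B.
have gE w : B w -> g w = M%:E - u w by move=> Bw; rewrite /g /patch mem_set.
have g0 w : 0 <= g w.
  by apply: erestrict_ge0 => x Bx; rewrite sube_ge0 ?orbT//; exact: uM.
have lg : lsc_on B g.
  move=> x Bx a; rewrite gE// => /(usc_on_lsc (usc_onS BD uu) Bx).
  by rewrite !near_withinE; apply: filterS => y h By; rewrite gE//; exact: h.
have -> : \int[mu]_(t in circ) (M%:E - u (circle_pt z r t)) =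
    \int[mu]_(t in circ) g (circle_pt z r t).
  by apply: eq_integral => t _; rewrite gE//; exact: disc_circle_pt.
rewrite -gE; last exact: closed_disc_refl.
apply: supermean_local_global => // w Bw.
move: (loc w (BD _ Bw)) (near_right_gt0 w); apply: filterS2 => -[y e] /= ye e0 yeB.
have BD' := subset_trans yeB BD.
have uM' x : closed_disc y e x -> u x <= M%:E by move=> /yeB; exact: uM.
have -> : \int[mu]_(t in circ) g (circle_pt y e t) =
   \int[mu]_(t in circ) (M%:E - u (circle_pt y e t)).
  by apply: eq_integral => t _; rewrite gE//; apply: yeB; exact: disc_circle_pt.
rewrite gE; last by apply: yeB; exact: closed_disc_refl.
by rewrite -(submeanP e0 uu BD' uM').
Unshelve. all: by end_near. Qed.

Lemma usc_on_max2 (T : topologicalType) (D : set T) (f g : T -> \bar R) :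
  usc_on D f -> usc_on D g -> usc_on D (fun x => maxe (f x) (g x)).
Proof.
move=> uf ug x Dx a; rewrite gt_max => /andP[/(uf x Dx) fa /(ug x Dx) ga].
by near=> y; rewrite gt_max; apply/andP; split; near: y.
Unshelve. all: by end_near. Qed.

Lemma submean_max D u v z (r : R) : (0 < r)%R -> usc_on D u -> usc_on D v ->
  (forall w, D w -> u w < +oo) -> (forall w, D w -> v w < +oo) ->
  closed_disc z r `<=` D ->
  u z <= circle_mean u z r -> v z <= circle_mean v z r ->
  maxe (u z) (v z) <= circle_mean (fun w => maxe (u w) (v w)) z r.
Proof.
move=> r0 uu uv ufin vfin BD su sv.
have um := usc_on_max2 uu uv.
have mfin w : D w -> maxe (u w) (v w) < +oo.
  by move=> Dw; rewrite gt_max ufin ?vfin.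
have [uvz|uvz] := leP (u z) (v z).
- have mz : v z = maxe (u z) (v z) by rewrite max_r.
  rewrite mz; apply: (submean_mono r0 uv um mfin BD _ mz) => // w _.
  by rewrite le_max lexx orbT.
- have mz : u z = maxe (u z) (v z) by rewrite max_l// ltW.
  rewrite mz; apply: (submean_mono r0 uu um mfin BD _ mz) => // w _.
  by rewrite le_max lexx.
Qed.

Lemma eq_submean u v z (r : R) : (0 < r)%R ->
  (forall w, closed_disc z r w -> u w = v w) ->
  u z <= circle_mean u z r -> v z <= circle_mean v z r.
Proof.
move=> r0 uv; rewrite uv; last exact: closed_disc_refl.
congr (_ <= _%:E * _); apply: eq_integral => t _; apply: uv.
exact: disc_circle_pt.
Qed.

Lemma near_submean D u z : open D -> subharmonic D u -> D z ->
  \forall y \near z & e \near (0%R : R)^'+,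
    [/\ (0 < e)%R, closed_disc y e `<=` D & u y <= circle_mean u y e].
Proof.
move=> oD [_ _ su] Dz.
move: (near_right_gt0 z) (near_closed_disc oD Dz); apply: filterS2 => -[y e] /= e0 yeD.
by split => //; exact: su.
Qed.

(** The open sets [A] and [D] minus [K] cover [D]. On the first the glued function is the maximum,
    by [f <= g] off [K]; on the second it is [g]. *)
Lemma usc_on_glue (T : topologicalType) (D A K : set T) (f g : T -> \bar R) :
  open D -> open A -> A `<=` D -> K `<=` A -> open (D `\` K) ->
  usc_on A f -> usc_on D g -> (forall x, A x -> ~ K x -> f x <= g x) ->
  usc_on D (fun x => if x \in K then maxe (f x) (g x) else g x).
Proof.
move=> oD oA AD KA oDK uf ug fg.
have um := usc_on_max2 uf (usc_onS AD ug).
set w := fun x => _.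
have wA x : A x -> w x = maxe (f x) (g x).
  move=> Az; rewrite /w; case: ifPn => // /negP zK.
  by rewrite max_r// fg// => Kz; apply: zK; rewrite inE.
have wDK x : (D `\` K) x -> w x = g x by move=> [_ Kz]; rewrite /w memNset.
move=> x Dz a; have [Kz|nKz] := pselect (K x).
  have Az := KA _ Kz.
  rewrite wA// => /(um x Az a); rewrite !near_withinE => h.
  have hA : \forall y \near x, A y by exact: open_nbhs_nbhs.
  by move: h hA; apply: filterS2 => y h Ay _; rewrite wA//; exact: h.
have DKz : (D `\` K) x by [].
rewrite wDK// => /(ug x Dz a); rewrite !near_withinE => h.
have hA : \forall y \near x, (D `\` K) y by exact: open_nbhs_nbhs.
by move: h hA; apply: filterS2 => y h Ay Dy; rewrite wDK//; exact: h.
Qed.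

(** Every sufficiently small disc lies in one of the two open pieces, where the glued function is a
    maximum or [v]; [subharmonic_local] does the rest. *)
Lemma subharmonic_glue D A K u v : open D -> open A -> A `<=` D -> K `<=` A ->
  open (D `\` K) -> subharmonic A u -> subharmonic D v ->
  (forall z, A z -> ~ K z -> u z <= v z) ->
  subharmonic D (fun z => if z \in K then maxe (u z) (v z) else v z).
Proof.
move=> oD oA AD KA oDK sA sD uv; set w := fun z => _.
have wA z : A z -> w z = maxe (u z) (v z).
  move=> Az; rewrite /w; case: ifPn => // /negP zK.
  by rewrite max_r// uv// => Kz; apply: zK; rewrite inE.
have wDK z : (D `\` K) z -> w z = v z by move=> [_ Kz]; rewrite /w memNset.
have [[uu ufin _] [uD vfin vsub]] := (sA, sD).
have sv : subharmonic (D `\` K) v.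
  split=> [|z [Dz _]|z r r0 h]; first exact: usc_onS uD.
    exact: vfin.
  by apply: vsub => // x /h[].
have DE z : D z -> A z \/ (D `\` K) z.
  by move=> Dz; have [Kz|Kz] := pselect (K z); [left; exact: KA|right].
apply: subharmonic_local => //.
- exact: usc_on_glue uv.
- move=> z Dz; have [Az|DKz] := DE _ Dz; last by rewrite wDK// vfin.
  by rewrite wA// gt_max ufin//= vfin.
- move=> z Dz; have [Az|DKz] := DE _ Dz; last first.
    have := near_submean oDK sv DKz; apply: filterS => -[y e] /= [e0 yeD].
    by apply: eq_submean => // x /yeD; exact: (esym \o @wDK x).
  have := near_submean oD sD (AD _ Az).
  have := near_submean oA sA Az; apply: filterS2 => -[y e] /= [e0 yeA su] [_ yeD sv'].
  apply: (@eq_submean (fun z => maxe (u z) (v z))) => //.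
    by move=> x /yeA /wA ->.
  apply: (submean_max e0 uu (usc_onS AD uD) ufin _ yeA su sv').
  by move=> x /AD; exact: vfin.
Qed.

Lemma affine_lty (C c : R) (x : \bar R) : (0 < C)%R -> x < +oo ->
  C%:E * x + c%:E < +oo.
Proof.
move=> C0; case: x => [x| |]// _; first by rewrite -EFinM -EFinD ltry.
by rewrite gt0_muleNy ?lte_fin.
Qed.

Lemma usc_on_affine (T : topologicalType) (D : set T) (f : T -> \bar R) (C c : R) :
  (0 < C)%R -> usc_on D f -> usc_on D (fun x => C%:E * f x + c%:E).
Proof.
move=> C0 uf.
have ltE (x : \bar R) (a : R) : (C%:E * x + c%:E < a%:E) = (x < ((a - c) / C)%:E).
  rewrite -lteBrDr// -EFinB muleC; case: x => [x| |].
  - by rewrite -EFinM !lte_fin ltr_pdivlMr.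
  - by rewrite gt0_mulye ?lte_fin.
  - by rewrite gt0_mulNye ?lte_fin// !ltNyr.
by move=> x Dx a; rewrite ltE => /(uf x Dx); apply: filterS => y; rewrite ltE.
Qed.

Lemma subharmonic_affine D u (C c : R) : (0 < C)%R -> subharmonic D u ->
  subharmonic D (fun z => C%:E * u z + c%:E).
Proof.
move=> C0 [uu ufin su].
have uu' := usc_on_affine (c := c) C0 uu.
have fin' z : D z -> C%:E * u z + c%:E < +oo by move=> /ufin; exact: affine_lty.
split=> // z r r0 BD.
have [M uM] := usc_disc_bound uu ufin BD.
have uM' w : closed_disc z r w -> C%:E * u w + c%:E <= (C * M + c)%:E.
  move=> /uM h; rewrite EFinD; apply: leeD => //; rewrite EFinM.
  by rewrite lee_pmul2l// lte_fin.
have E (x : \bar R) : (C * M + c)%:E - (C%:E * x + c%:E) = C%:E * (M%:E - x).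
  case: x => [x| |].
  - by rewrite -EFinM -EFinD -!EFinB -EFinM; congr (_%:E); ring.
  - by rewrite gt0_muley ?lte_fin//= addeNy gt0_muleNy ?lte_fin.
  - by rewrite gt0_muleNy ?lte_fin//= gt0_muley ?lte_fin.
rewrite (submeanP r0 uu' BD uM').
under eq_integral do rewrite E.
rewrite E ge0_integralZl//; last 3 first.
- apply: emeasurable_funB; first exact: measurable_cst.
  by apply: (measurable_circle_usc uu) => t; apply: BD; exact: disc_circle_pt.
- by move=> t _; rewrite sube_ge0 ?orbT//; apply: uM; exact: disc_circle_pt.
- by rewrite lee_fin ltW.
rewrite muleCA lee_pmul2l// ?lte_fin// -(submeanP r0 uu BD uM).
exact: su.
Qed.

(** The hypotheses say that [u_ n] decreases to [u]. A bound of [u_ 0] on the disc serves all [n],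
    so Fatou applies to [M - u_ n]. *)
Lemma subharmonic_lim D u (u_ : nat -> R * R -> \bar R) :
  usc_on D u -> (forall n, subharmonic D (u_ n)) ->
  (forall n z, D z -> u z <= u_ n z) ->
  (forall z, D z -> nonincreasing_seq (u_ ^~ z)) ->
  (forall z (a : R), D z -> u z < a%:E -> \forall n \near \oo, u_ n z < a%:E) ->
  subharmonic D u.
Proof.
move=> uu su ule dec lim.
have ufin z : D z -> u z < +oo.
  by move=> Dz; have [_ /(_ z Dz) h _] := su 0%N; exact: le_lt_trans (ule _ _ Dz) h.
split=> // z r r0 BD.
have [u0 u0fin _] := su 0%N.
have [M u0M] := usc_disc_bound u0 u0fin BD.
have u_M n w : closed_disc z r w -> u_ n w <= M%:E.
  by move=> Bw; apply: le_trans (u0M _ Bw); exact: dec (BD _ Bw) _ _ (leq0n n).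
have uM w : closed_disc z r w -> u w <= M%:E.
  by move=> Bw; apply: le_trans (u0M _ Bw); exact: ule (BD _ Bw).
rewrite (submeanP r0 uu BD uM).
have mu_ n : measurable_fun circ (fun t => M%:E - u_ n (circle_pt z r t)).
  apply: emeasurable_funB; first exact: measurable_cst.
  have [uun _ _] := su n.
  by apply: (measurable_circle_usc uun) => t; apply: BD; exact: disc_circle_pt.
apply: (@le_trans _ _ (\int[mu]_(t in circ)
    limn_einf (fun n => M%:E - u_ n (circle_pt z r t)))).
  apply: ge0_le_integral => //.
  - by move=> t _; rewrite sube_ge0 ?orbT//; apply: uM; exact: disc_circle_pt.
  - apply: emeasurable_funB; first exact: measurable_cst.
    by apply: (measurable_circle_usc uu) => t; apply: BD; exact: disc_circle_pt.
  - rewrite /limn_einf; apply: measurableT_comp => //.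
    apply: (measurable_fun_limn_esup
      (f := fun n t => - (M%:E - u_ n (circle_pt z r t)))) => n.
    exact: measurableT_comp.
  - move=> t _; apply: limn_einf_ge => a.
    rewrite lte_EFinBr => /(lim _ _ (BD _ (disc_circle_pt z t r0))).
    by apply: filterS => n; rewrite lte_EFinBr.
apply: (le_trans (@fatou _ _ R mu circ measurable_circ _ mu_ _)) => //.
  by move=> n t _; rewrite sube_ge0 ?orbT//; apply: u_M; exact: disc_circle_pt.
apply: limn_einf_le => n.
have [uun _ sun] := su n.
have := sun z r r0 BD; rewrite (submeanP r0 uun BD (u_M n)) => /le_trans; apply.
rewrite lee_pmul2l// ?lte_fin ?mulr_gt0 ?pi_gt0//.
by apply: leeB => //; apply: ule; apply: BD; exact: closed_disc_refl.
Qed.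

End planar.

(** * Quaternions *)

Section quaternion_norm.
Context {R : realType}.
Implicit Types p q b h I : quat R.

Local Notation "q ''_' k" := (qcoord q k%N) (at level 8, k at level 2).

Lemma qcoordM p q :
  ((p * q) '_0 = p '_0 * q '_0 - p '_1 * q '_1 - p '_2 * q '_2 - p '_3 * q '_3) *
  ((p * q) '_1 = p '_0 * q '_1 + p '_1 * q '_0 + p '_2 * q '_3 - p '_3 * q '_2) *
  ((p * q) '_2 = p '_0 * q '_2 - p '_1 * q '_3 + p '_2 * q '_0 + p '_3 * q '_1) *
  ((p * q) '_3 = p '_0 * q '_3 + p '_1 * q '_2 - p '_2 * q '_1 + p '_3 * q '_0).
Proof.
have -> : p * q = qmul p q by [].
by rewrite /qmul !qcoord_mkquat.
Qed.

Lemma qcoordN q k : (- q) '_k = - q '_k.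
Proof. by rewrite /qcoord mxE. Qed.

Lemma qcoord0 k : (0 : quat R) '_k = 0.
Proof. by rewrite /qcoord mxE. Qed.

Lemma qcoord1 : ((1 : quat R) '_0 = 1) * ((1 : quat R) '_1 = 0) *
  ((1 : quat R) '_2 = 0) * ((1 : quat R) '_3 = 0).
Proof.
have -> : (1 : quat R) = qone R by [].
by rewrite /qone !qcoord_mkquat.
Qed.

Definition qcoordE := (qcoordN, qcoord0, qcoord1, qcoordM, qcoordD, qcoordZ).

Definition qdot p q := p '_0 * q '_0 + p '_1 * q '_1 + p '_2 * q '_2 + p '_3 * q '_3.

Lemma qdot_ge0 q : 0 <= qdot q q.
Proof. by rewrite /qdot -!expr2 !addr_ge0 ?sqr_ge0. Qed.

Lemma qnormE q : qnorm q = Num.sqrt (qdot q q).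
Proof.
rewrite /qnorm /qdot !big_ord_recr big_ord0/= add0r.
by rewrite -!expr2.
Qed.

Lemma sqr_qnorm q : qnorm q ^+ 2 = qdot q q.
Proof. by rewrite qnormE sqr_sqrtr// qdot_ge0. Qed.

Lemma qnorm_ge0 q : 0 <= qnorm q. Proof. exact: sqrtr_ge0. Qed.

Lemma qdot_eq0 q : (qdot q q == 0) = (q == 0).
Proof.
apply/eqP/eqP => [q0|->]; last by rewrite /qdot !qcoordE; ring.
have [h0 h1 h2 h3] : [/\ q '_0 = 0, q '_1 = 0, q '_2 = 0 & q '_3 = 0].
  by move: q0; rewrite /qdot => q0; split; nra.
by apply: qcoord_eqP => -[|[|[|[|//]]]] _; rewrite qcoordE.
Qed.

Lemma qnorm_eq0 q : (qnorm q == 0) = (q == 0).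
Proof. by rewrite -qdot_eq0 -sqr_qnorm sqrf_eq0. Qed.

Lemma qnorm_gt0 q : (0 < qnorm q) = (q != 0).
Proof. by rewrite lt_def qnorm_ge0 andbT qnorm_eq0. Qed.

(** Euler's four-square identity. *)
Lemma qdotM p q : qdot (p * q) (p * q) = qdot p p * qdot q q.
Proof. by rewrite /qdot !qcoordE; ring. Qed.

Lemma qnormM p q : qnorm (p * q) = qnorm p * qnorm q.
Proof. by rewrite !qnormE qdotM sqrtrM// qdot_ge0. Qed.

Lemma qdot_CS p q : qdot p q <= qnorm p * qnorm q.
Proof.
have h : qdot p q ^+ 2 <= (qnorm p * qnorm q) ^+ 2.
  rewrite exprMn !sqr_qnorm -subr_ge0.
  (* Lagrange's identity in dimension four. *)
  have -> : qdot p p * qdot q q - qdot p q ^+ 2 =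
    (p '_0 * q '_1 - p '_1 * q '_0) ^+ 2 + (p '_0 * q '_2 - p '_2 * q '_0) ^+ 2 +
    (p '_0 * q '_3 - p '_3 * q '_0) ^+ 2 + (p '_1 * q '_2 - p '_2 * q '_1) ^+ 2 +
    (p '_1 * q '_3 - p '_3 * q '_1) ^+ 2 + (p '_2 * q '_3 - p '_3 * q '_2) ^+ 2.
    by rewrite /qdot; ring.
  by rewrite !addr_ge0 ?sqr_ge0.
have pq0 : 0 <= qnorm p * qnorm q by rewrite mulr_ge0 ?qnorm_ge0.
apply: (le_trans (ler_norm _)).
by rewrite -(@ler_pXn2r _ 2)// ?nnegrE// real_normK ?num_real.
Qed.

Lemma ler_qnormD p q : qnorm (p + q) <= qnorm p + qnorm q.
Proof.
have pq0 : 0 <= qnorm p + qnorm q by rewrite addr_ge0 ?qnorm_ge0.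
rewrite -(@ler_pXn2r _ 2)// ?nnegrE ?qnorm_ge0// sqrrD !sqr_qnorm.
have -> : qdot (p + q) (p + q) = qdot p p + qdot p q *+ 2 + qdot q q.
  by rewrite /qdot !qcoordE; ring.
by rewrite lerD2r lerD2l lerMn2r qdot_CS orbT.
Qed.

Lemma qnormN q : qnorm (- q) = qnorm q.
Proof. by rewrite !qnormE; congr Num.sqrt; rewrite /qdot !qcoordE; ring. Qed.

Lemma qnorm_distC p q : qnorm (p - q) = qnorm (q - p).
Proof. by rewrite -qnormN opprB. Qed.

Definition qinv q : quat R :=
  (qdot q q)^-1 *: mkquat (q '_0) (- q '_1) (- q '_2) (- q '_3).

Lemma qmulqV q : q != 0 -> q * qinv q = 1.
Proof.
move=> q0; have d0 : qdot q q != 0 by rewrite qdot_eq0.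
rewrite /qinv -scalerAr.
have -> : q * mkquat (q '_0) (- q '_1) (- q '_2) (- q '_3) = qdot q q *: 1.
  by apply: qcoord_eqP => -[|[|[|[|//]]]] _; rewrite !qcoordE !qcoord_mkquat//= /qdot; ring.
by rewrite scalerA mulVf// scale1r.
Qed.

(** The imaginary coordinates of [I ^+ 2 = -1] say that twice the real part times each imaginary
    part vanishes. A nonzero real part would make [I] real, with square -1. *)
Lemma imag_unitP I : imag_unit I ->
  I '_0 = 0 /\ I '_1 ^+ 2 + I '_2 ^+ 2 + I '_3 ^+ 2 = 1.
Proof.
rewrite /imag_unit/= expr2 => II.
have e0 := congr1 (fun q => q '_0) II; have e1 := congr1 (fun q => q '_1) II.
have e2 := congr1 (fun q => q '_2) II; have e3 := congr1 (fun q => q '_3) II.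
rewrite !qcoordE in e0 e1 e2 e3.
have I0 : I '_0 = 0.
  apply/eqP/negPn/negP => n0.
  have z x : I '_0 * x + x * I '_0 = 0 -> x = 0.
    move=> /eqP; rewrite [x * _]mulrC -mulr2n mulrn_eq0/= mulf_eq0 (negbTE n0)/=.
    by move=> /eqP.
  have z1 : I '_1 = 0 by apply: z; lra.
  have z2 : I '_2 = 0 by apply: z; lra.
  have z3 : I '_3 = 0 by apply: z; lra.
  by move: e0; rewrite z1 z2 z3; nra.
by split => //; move: e0; rewrite I0 !expr2; lra.
Qed.

Lemma imag_unit_dot I b : imag_unit I ->
  qdot (I * b) (I * b) = qdot b b /\ qdot b (I * b) = 0.
Proof.
move=> /imag_unitP[I0 I1]; split.
  rewrite qdotM; have -> : qdot I I = 1 by rewrite /qdot I0 -I1; ring.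
  by rewrite mul1r.
by rewrite /qdot !qcoordE I0; ring.
Qed.

(** Bessel's inequality for [b] and [I * b], which are orthogonal and of equal length. After
    cancelling [qdot q b ^+ 2] it is Cauchy-Schwarz in dimension three between the unit vector of
    imaginary parts of [I] and [M]. *)
Lemma imag_unit_bessel I b q : imag_unit I ->
  qdot q b ^+ 2 + qdot q (I * b) ^+ 2 <= qdot q q * qdot b b.
Proof.
move=> /imag_unitP[I0 I1].
(* [M] is the imaginary part of [q * conj b]. *)
pose M1 := q '_1 * b '_0 - q '_0 * b '_1 - q '_2 * b '_3 + q '_3 * b '_2.
pose M2 := q '_2 * b '_0 - q '_0 * b '_2 - q '_3 * b '_1 + q '_1 * b '_3.
pose M3 := q '_3 * b '_0 - q '_0 * b '_3 - q '_1 * b '_2 + q '_2 * b '_1.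
have E1 : qdot q (I * b) = I '_1 * M1 + I '_2 * M2 + I '_3 * M3.
  by rewrite /qdot !qcoordE I0 /M1 /M2 /M3; ring.
have E2 : qdot q q * qdot b b = qdot q b ^+ 2 + 1 * (M1 ^+ 2 + M2 ^+ 2 + M3 ^+ 2).
  by rewrite /qdot /M1 /M2 /M3; ring.
rewrite E1 E2 lerD2l -I1 -subr_ge0.
have -> : (I '_1 ^+ 2 + I '_2 ^+ 2 + I '_3 ^+ 2) * (M1 ^+ 2 + M2 ^+ 2 + M3 ^+ 2) -
    (I '_1 * M1 + I '_2 * M2 + I '_3 * M3) ^+ 2 =
    (I '_1 * M2 - I '_2 * M1) ^+ 2 + (I '_1 * M3 - I '_3 * M1) ^+ 2 +
    (I '_2 * M3 - I '_3 * M2) ^+ 2 by ring.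
by rewrite !addr_ge0 ?sqr_ge0.
Qed.

Lemma slice_mul I b (z : R * R) : slice I z * b = z.1 *: b + z.2 *: (I * b).
Proof. by rewrite /slice mulrDl -!scalerAl mul1r. Qed.

Lemma qdot_line I (q b : quat R) (x y : R) : imag_unit I ->
  qdot (q + (x *: b + y *: (I * b))) (q + (x *: b + y *: (I * b))) =
  qdot q q + (x ^+ 2 + y ^+ 2) * qdot b b + 2 * (x * qdot q b + y * qdot q (I * b)).
Proof.
move=> /(@imag_unit_dot I b)[E1 E2].
have -> : (x ^+ 2 + y ^+ 2) * qdot b b = x ^+ 2 * qdot b b +
   y ^+ 2 * qdot (I * b) (I * b) + 2 * x * y * qdot b (I * b).
  by rewrite E1 E2; ring.
by rewrite /qdot !qcoordD !qcoordZ; ring.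
Qed.

Lemma qcoord_continuous k : continuous (fun q : quat R => q '_k).
Proof. by move=> q; exact: coord_continuous. Qed.

Lemma qdot_continuous (q0 : quat R) :
  continuous (fun q : quat R => qdot (q - q0) (q - q0)).
Proof.
have c k : continuous (fun q : quat R => (q - q0) '_k).
  under eq_fun do rewrite qcoordD qcoordN.
  by apply: continuous_funB; [exact: qcoord_continuous|exact: continuous_fun_cst].
by rewrite /qdot; repeat apply: continuous_funD; apply: continuous_funM.
Qed.

Lemma qnorm_continuous (q0 : quat R) : continuous (fun q : quat R => qnorm (q - q0)).
Proof.
under eq_fun do rewrite qnormE.
by apply: continuous_fun_comp; [exact: qdot_continuous|exact: sqrt_continuous].
Qed.

Definition qbasis (k : nat) : quat R :=
  mkquat (k == 0)%N%:R (k == 1)%N%:R (k == 2)%N%:R (k == 3)%N%:R.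

Lemma qbasisE q : q = q '_0 *: qbasis 0 + q '_1 *: qbasis 1 +
  q '_2 *: qbasis 2 + q '_3 *: qbasis 3.
Proof.
by apply: qcoord_eqP => -[|[|[|[|//]]]] _;
  rewrite !(qcoordD, qcoordZ) !qcoord_mkquat//=; ring.
Qed.

Lemma qmulr_continuous (h : quat R) : continuous (fun q : quat R => q * h).
Proof.
have -> : (fun q : quat R => q * h) = (fun q =>
    q '_0 *: (qbasis 0 * h) + q '_1 *: (qbasis 1 * h) +
    q '_2 *: (qbasis 2 * h) + q '_3 *: (qbasis 3 * h)).
  by apply/funext => q; rewrite {1}(qbasisE q) !mulrDl -!scalerAl.
move=> q; have c k : (fun p : quat R => p '_k *: (qbasis k * h)) @ q -->
    q '_k *: (qbasis k * h).
  exact: (cvgZ (@qcoord_continuous k q) (cvg_cst _)).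
exact: (cvgD (cvgD (cvgD (c 0%N) (c 1%N)) (c 2%N)) (c 3%N)).
Qed.

Lemma line_continuous (I a b : quat R) :
  continuous (fun z : R * R => a + slice I z * b).
Proof.
move=> z; under eq_fun do rewrite slice_mul.
apply: cvgD; first exact: cvg_cst.
by apply: cvgD; [exact: (cvgZ cvg_fst (cvg_cst _))|exact: (cvgZ cvg_snd (cvg_cst _))].
Qed.

Lemma qcoord_le q k : (k < 4)%N -> `|q '_k| <= qnorm q.
Proof.
move=> k4; rewrite -(@ler_pXn2r _ 2)// ?nnegrE ?qnorm_ge0// real_normK ?num_real//.
rewrite sqr_qnorm /qdot; move: k k4 => [|[|[|[|//]]]] _; nra.
Qed.

(** Bridges the topology, which comes from the sup norm, and the Euclidean norm in which the pole
    and all estimates are written. *)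
Lemma nbhs_qball (q : quat R) (U : set (quat R)) :
  nbhs q U <-> exists2 r : R, 0 < r & forall p, qnorm (p - q) < r -> U p.
Proof.
split=> [/nbhs_ballP[e /= e0 eU]|[r r0 rU]].
  (* Expanding in the basis bounds the sup norm by [C] times the Euclidean norm; the summand 1 makes
     [C] visibly positive. *)
  pose C := `|qbasis 0| + `|qbasis 1| + `|qbasis 2| + `|qbasis 3| + 1.
  have C0 : 0 < C by rewrite /C ltr_wpDl// !addr_ge0.
  exists (e / C) => [|p]; first by rewrite divr_gt0.
  rewrite ltr_pdivlMr// => pq; apply: eU; rewrite -ball_normE/= distrC.
  apply: le_lt_trans pq; set d := p - q.
  have d0 := qnorm_ge0 d.
  have B k : (k < 4)%N -> `|d '_k *: qbasis k| <= qnorm d * `|qbasis k|.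
    by move=> k4; rewrite normrZ ler_wpM2r// qcoord_le.
  rewrite {1}(qbasisE d) /C !mulrDr mulr1.
  apply: (@le_trans _ _ (qnorm d * `|qbasis 0| + qnorm d * `|qbasis 1| +
    qnorm d * `|qbasis 2| + qnorm d * `|qbasis 3|)); last by rewrite lerDl.
  by repeat (apply: (le_trans (ler_normD _ _)); apply: lerD; last exact: B); exact: B.
have : \forall p \near q, qnorm (p - q) < r.
  have := @qnorm_continuous q q; rewrite /continuous_at subrr => c.
  apply: (cvgr_lt _ c).
  by rewrite qnormE (_ : qdot 0 0 = 0) ?sqrtr0//; apply/eqP; rewrite qdot_eq0.
by apply: filterS => p; exact: rU.
Qed.

Lemma bounded_qnorm (A : set (quat R)) (q0 : quat R) : bounded_set A ->
  exists2 M : R, 0 < M & forall q, A q -> qnorm (q - q0) < M.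
Proof.
move=> [M [_ HM]]; pose B := `|M| + 1.
have MB : M < B by rewrite /B (le_lt_trans (ler_norm M))// ltrDl.
have B0 : 0 < B by rewrite /B ltr_wpDl.
exists (2 * B + qnorm q0 + 1) => [|q Aq].
  by have := qnorm_ge0 q0; lra.
have qB k : `|q '_k| <= B.
  apply: le_trans (HM B MB q Aq).
  by rewrite [leRHS]/Num.Def.normr/= mx_normrE; apply/bigmax_geP; right; exists (ord0, inord k).
have qk k : q '_k * q '_k <= B ^+ 2.
  by rewrite -expr2 -real_normK ?num_real// ler_pXn2r// ?nnegrE// ltW.
have : qnorm q <= 2 * B.
  rewrite -(@ler_pXn2r _ 2)// ?nnegrE ?qnorm_ge0//; last lra.
  rewrite sqr_qnorm /qdot exprMn.
  by have [] := (qk 0%N, qk 1%N); have [] := (qk 2%N, qk 3%N); lra.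
have := ler_qnormD q (- q0); rewrite qnormN; lra.
Qed.

End quaternion_norm.

(** * The logarithmic pole *)

Section log_subharmonic.
Context {R : realType}.
Local Notation mu := lebesgue_measure.

Lemma continuous_usc_on (T : topologicalType) (D : set T) (h : T -> R) :
  continuous h -> usc_on D (fun x => (h x)%:E).
Proof.
move=> ch x Dx a; rewrite lte_fin => hxa; rewrite near_withinE.
have : \forall y \near x, h y < a by exact: (cvgr_lt _ (ch x)).
by apply: filterS => y hy _; rewrite lte_fin.
Qed.

(** By rotation invariance the circle mean is also the mean of the averages over the four vertices
    of inscribed squares. A pointwise inequality therefore suffices, and no integral of a logarithm
    is computed. *)
Lemma four_point_submean (h : R * R -> R) (z : R * R) (r : R) : 0 < r ->
  continuous h ->
  (forall t, 4 * h z <= h (circle_pt z r t) + h (circle_pt z r (t + pi / 2)) +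
    h (circle_pt z r (t + pi)) + h (circle_pt z r (t + (pi + pi / 2)))) ->
  ((h z)%:E <= circle_mean (fun w => (h w)%:E) z r)%E.
Proof.
move=> r0 ch h4; have pi0 := pi_gt0 R.
have uh : usc_on setT (fun w => (h w)%:E) by exact: continuous_usc_on.
have [M hM] := @usc_disc_bound R setT (fun w => (h w)%:E) z r uh
  (fun w _ => ltry (h w)) (@subsetT _ _).
rewrite (submeanP r0 uh (@subsetT _ _) hM).
pose g t := (M%:E - (h (circle_pt z r t))%:E)%E.
have g0 t : (0 <= g t)%E by rewrite /g sube_ge0//; apply: hM; exact: disc_circle_pt.
have mg : measurable_fun setT g.
  apply/measurable_EFinP; apply: continuous_measurable_fun.
  apply: continuous_funB; first exact: continuous_fun_cst.
  by move=> t; apply: continuous_comp; [exact: continuous_circle_pt|exact: ch].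
have gper t : g (t + pi *+ 2) = g t by rewrite /g /circle_pt cosD2pi sinD2pi.
have S (th : R) : 0 <= th <= 2 * pi ->
    (\int[mu]_(t in circ) g (t + th)%R = \int[mu]_(t in circ) g t)%E.
  by move=> h'; exact: integral_circ_shift.
have mgs (th : R) : measurable_fun circ (fun t => g (t + th)).
  apply: measurable_funTS; apply: measurableT_comp => //.
  by apply: measurable_funD => //; exact: measurable_cst.
have : (\int[mu]_(t in circ) g (t + 0)%R + \int[mu]_(t in circ) g (t + pi / 2)%R +
    \int[mu]_(t in circ) g (t + pi)%R + \int[mu]_(t in circ) g (t + (pi + pi / 2))%R <=
    (2 * pi)%:E * (4 * (M - h z))%:E)%E.
  rewrite -integral_circle_cst -!ge0_integralD//;
    try (by move=> t _; repeat first [exact: g0 | apply: adde_ge0]);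
    try (by repeat first [exact: mgs | apply: emeasurable_funD]).
  apply: ge0_le_integral => //.
  - by move=> t _; repeat first [exact: g0 | apply: adde_ge0].
  - by repeat first [exact: mgs | apply: emeasurable_funD].
  - move=> t _; rewrite /g -!EFinB -!EFinD lee_fin addr0.
    by have := h4 t; lra.
rewrite !S; try (by apply/andP; split; lra).
rewrite /g; move: (\int[mu]_(t in circ) _)%E => [x| |]//.
  by rewrite -?EFinD -?EFinB -?EFinM !lee_fin; nra.
by move=> _; exact: leNye.
Qed.

(** Here [N] stands for [|q|^2 + d], [X] for [e^2 |b|^2], and the four factors for the values at the
    vertices of a square; the bound on [e ^+ 2 * G] is Bessel's inequality. The regularization pays
    for the estimate: the term [2 * N ^+ 2 * X * (2 * d - X)] is nonnegative only for [X <= 2 * d],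
    and with [d = 0] the bound fails for small squares. *)
Lemma ln_four_points (N X G A B e d : R) : 0 < d -> d <= N -> 0 <= X <= 2 * d ->
  e ^+ 2 * G <= X * (N - d) -> A ^+ 2 + B ^+ 2 = G ->
  N ^+ 4 <= (N + X + 2 * e * A) * (N + X + 2 * e * B) *
            (N + X - 2 * e * A) * (N + X - 2 * e * B).
Proof.
move=> d0 dN /andP[X0 Xd] eG AB.
have N0 : 0 < N by lra.
have -> : (N + X + 2 * e * A) * (N + X + 2 * e * B) *
    (N + X - 2 * e * A) * (N + X - 2 * e * B) =
    (N + X) ^+ 4 - 4 * (N + X) ^+ 2 * (e ^+ 2 * G) + (4 * e ^+ 2 * A * B) ^+ 2.
  by rewrite -AB; ring.
have h1 : 4 * (N + X) ^+ 2 * (e ^+ 2 * G) <= 4 * (N + X) ^+ 2 * (X * (N - d)).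
  by apply: ler_wpM2l => //; rewrite mulr_ge0// sqr_ge0.
have h2 := sqr_ge0 (4 * e ^+ 2 * A * B).
have h3 : (N + X) ^+ 4 - 4 * (N + X) ^+ 2 * (X * (N - d)) - N ^+ 4 =
   2 * N ^+ 2 * X * (2 * d - X) + X ^+ 4 + 4 * X ^+ 2 * d * (2 * N + X) by ring.
have h4 : 0 <= 2 * N ^+ 2 * X * (2 * d - X).
  by rewrite (mulr_ge0 (mulr_ge0 (mulr_ge0 _ (sqr_ge0 _)) X0))// subr_ge0.
have h5 : 0 <= X ^+ 4 by rewrite exprn_ge0.
have h6 : 0 <= 4 * X ^+ 2 * d * (2 * N + X).
  by rewrite (mulr_ge0 (mulr_ge0 (mulr_ge0 _ (sqr_ge0 _)) (ltW d0)))//; lra.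
lra.
Qed.

(** A smoothed [log |q - q0|], decreasing to it as [d] tends to 0; the division by 2 accounts for
    the squared norm. *)
Definition logd (d : R) (q0 q : quat R) : R :=
  ln (qdot (q - q0) (q - q0) + d) / 2.

Lemma logd_continuous d q0 : 0 < d -> continuous (logd d q0).
Proof.
move=> d0; apply: continuous_funM; last exact: continuous_fun_cst.
move=> q; apply: continuous_comp.
  exact: (continuous_funD (@qdot_continuous R q0) (@continuous_fun_cst _ _ d)).
by apply: continuous_ln; exact: (ltr_wpDl (qdot_ge0 _) d0).
Qed.

Lemma logd_subharmonic (I a b q0 : quat R) (d : R) : imag_unit I -> 0 < d ->
  subharmonic setT (fun z => (logd d q0 (a + slice I z * b))%:E).
Proof.
move=> I1 d0.
have c : continuous (fun z => logd d q0 (a + slice I z * b)).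
  move=> z; apply: (@continuous_comp _ _ _ (fun z => a + slice I z * b) (logd d q0) z).
    exact: line_continuous.
  exact: logd_continuous.
apply: subharmonic_local.
- exact: openT.
- exact: continuous_usc_on.
- by move=> z _; rewrite ltry.
move=> w _.
have [e0 e0p he0] : exists2 e0 : R, 0 < e0 & e0 ^+ 2 * qdot b b <= 2 * d.
  have b0 := qdot_ge0 b.
  (* The cap 1 gives [m ^+ 2 <= m], and the second bound gives [m * qdot b b <= d]; the denominator
     [qdot b b + 1] stays positive when [b = 0]. *)
  exists (Num.min 1 (d / (qdot b b + 1))).
    by rewrite lt_min ltr01 divr_gt0// ltr_wpDl.
  set m := Num.min _ _.
  have m0 : 0 < m by rewrite lt_min ltr01 divr_gt0// ltr_wpDl.
  have m1 : m <= 1 by rewrite ge_min lexx.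
  have m2 : m <= d / (qdot b b + 1) by rewrite ge_min lexx orbT.
  have h : m * (qdot b b + 1) <= d by rewrite -ler_pdivlMr// ltr_wpDl.
  nra.
exists (setT, [set e : R | 0 < e < e0]).
  split; first exact: filterT.
  near=> e => /=; apply/andP; split; near: e; first exact: nbhs_right_gt.
  exact: nbhs_right_lt.
move=> [y e] /= [_ /andP[ep ee0]].
apply: four_point_submean => // t.
set q := a + slice I y * b - q0.
pose F (x x' : R) := qdot q q + d + e ^+ 2 * qdot b b + 2 * e * (x * qdot q b + x' * qdot q (I * b)).
have FE x x' : F x x' = qdot q q + d + e ^+ 2 * qdot b b +
  2 * e * (x * qdot q b + x' * qdot q (I * b)) by [].
clearbody F.
have E s : qdot (a + slice I (circle_pt y e s) * b - q0)
    (a + slice I (circle_pt y e s) * b - q0) + d = F (cos s) (sin s).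
  have -> : a + slice I (circle_pt y e s) * b - q0 =
      q + ((e * cos s) *: b + (e * sin s) *: (I * b)).
    rewrite /q !slice_mul /circle_pt/= !scalerDl.
    by rewrite addrACA (addrA a) (addrAC _ _ (- q0)).
  rewrite qdot_line// FE.
  have -> : (e * cos s) ^+ 2 + (e * sin s) ^+ 2 = e ^+ 2 * (cos s ^+ 2 + sin s ^+ 2) by ring.
  by rewrite cos2Dsin2; ring.
have Fp s : 0 < F (cos s) (sin s) by rewrite -E ltr_wpDl// qdot_ge0.
have LE s : logd d q0 (a + slice I (circle_pt y e s) * b) = ln (F (cos s) (sin s)) / 2.
  by rewrite /logd E.
have Ly : logd d q0 (a + slice I y * b) = ln (qdot q q + d) / 2 by [].
rewrite Ly !LE.
have -> : 4 * (ln (qdot q q + d) / 2) = ln ((qdot q q + d) ^+ 4) / 2.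
  by rewrite lnXn ?ltr_wpDl ?qdot_ge0// -mulr_natl; ring.
rewrite -!mulrDl ler_pM2r//.
rewrite -!lnM ?posrE ?mulr_gt0//.
rewrite ler_ln ?posrE ?mulr_gt0 ?exprn_gt0 ?ltr_wpDl ?qdot_ge0//.
have e1 : cos (t + (pi + pi / 2)) = sin t by rewrite addrA cosDpihalf sinDpi opprK.
have e2 : sin (t + (pi + pi / 2)) = - cos t by rewrite addrA sinDpihalf cosDpi.
rewrite e1 e2 cosDpihalf sinDpihalf cosDpi sinDpi.
have B0 := qdot_ge0 b; have q00 := qdot_ge0 q.
have X2d : e ^+ 2 * qdot b b <= 2 * d.
  apply: le_trans he0; apply: ler_wpM2r => //.
  by rewrite ler_pXn2r// ?nnegrE ltW.
(* The last two coordinates are the vector [(qdot q b, qdot q (I * b))] rotated by the angle [t], so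
   their squares add up to a quantity free of [t]. *)
apply: le_trans (@ln_four_points (qdot q q + d) (e ^+ 2 * qdot b b)
  (qdot q b ^+ 2 + qdot q (I * b) ^+ 2)
  (cos t * qdot q b + sin t * qdot q (I * b))
  (cos t * qdot q (I * b) - sin t * qdot q b) e d d0 _ _ _ _) _.
- by rewrite lerDr.
- by rewrite X2d andbT mulr_ge0// sqr_ge0.
- rewrite addrK -(mulrA (e ^+ 2)); apply: ler_wpM2l; first exact: sqr_ge0.
  by rewrite [leRHS]mulrC; exact: imag_unit_bessel.
- transitivity ((cos t ^+ 2 + sin t ^+ 2) * (qdot q b ^+ 2 + qdot q (I * b) ^+ 2)).
    by ring.
  by rewrite cos2Dsin2 mul1r.
- by rewrite le_eqVlt; apply/orP; left; apply/eqP; rewrite !FE; ring.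
Unshelve. all: by end_near. Qed.

(** The pole is set by hand: [ln] has the default value 0 at 0, which would violate the submean
    inequality there. *)
Definition qlog (q0 q : quat R) : \bar R :=
  if q == q0 then -oo%E else (ln (qnorm (q - q0)))%:E.

Lemma qlog_lt (q0 q : quat R) (a : R) :
  (qlog q0 q < a%:E)%E = (qdot (q - q0) (q - q0) < expR (2 * a)).
Proof.
rewrite /qlog; case: ifPn => [/eqP ->|qq0].
  by rewrite subrr ltNyr (eqP (_ : qdot 0 0 == 0)) ?expR_gt0// qdot_eq0.
have p : 0 < qnorm (q - q0) by rewrite qnorm_gt0 subr_eq0.
rewrite lte_fin -sqr_qnorm expRM_natl -{1}(expRK a) ltr_ln ?posrE ?expR_gt0//.
by rewrite ltr_pXn2r// nnegrE ?expR_ge0// qnorm_ge0.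
Qed.

Lemma qlog_usc (q0 : quat R) : usc_on setT (qlog q0).
Proof.
move=> q _ a; rewrite qlog_lt near_withinE => qa.
have : \forall y \near q, qdot (y - q0) (y - q0) < expR (2 * a).
  exact: (cvgr_lt _ (@qdot_continuous R q0 q)).
by apply: filterS => y h _; rewrite qlog_lt.
Qed.

(** Decreasing limit of [logd] along [d = 1 / (n + 1)]. *)
Lemma qlog_subharmonic (I a b q0 : quat R) : imag_unit I ->
  subharmonic setT (fun z => qlog q0 (a + slice I z * b)).
Proof.
move=> I1.
have logd_lt d q x : 0 < d ->
    ((logd d q0 q)%:E < x%:E)%E = (qdot (q - q0) (q - q0) + d < expR (2 * x)).
  move=> d0; have p : 0 < qdot (q - q0) (q - q0) + d by rewrite ltr_wpDl// qdot_ge0.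
  by rewrite lte_fin /logd ltr_pdivrMr// mulrC -{1}(expRK (2 * x)) ltr_ln// posrE expR_gt0.
have dn (n : nat) : 0 < n.+1%:R^-1 :> R by rewrite invr_gt0.
apply: (@subharmonic_lim _ _ _
  (fun n z => (logd n.+1%:R^-1 q0 (a + slice I z * b))%:E)).
- exact: (usc_on_comp (@qlog_usc q0) (@line_continuous R I a b)).
- by move=> n; exact: logd_subharmonic.
- move=> n z _; rewrite /qlog; case: ifPn => [_|zq]; first exact: leNye.
  have p : 0 < qnorm (a + slice I z * b - q0) by rewrite qnorm_gt0 subr_eq0.
  rewrite lee_fin /logd ler_pdivlMr// mulrC.
  have -> : 2 * ln (qnorm (a + slice I z * b - q0)) =
      ln (qnorm (a + slice I z * b - q0) ^+ 2).
    by rewrite lnXn// mulr_natl.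
  have p2 : 0 < qnorm (a + slice I z * b - q0) ^+ 2 by rewrite exprn_gt0.
  rewrite -sqr_qnorm ler_ln ?posrE//; first by rewrite lerDl ltW.
  by rewrite ltr_wpDl// ltW.
- move=> z _ m n mn; rewrite lee_fin /logd ler_pM2r// ler_ln ?posrE ?ltr_wpDl ?qdot_ge0//.
  by rewrite lerD2l lef_pV2 ?posrE// ler_nat.
- move=> z x _; rewrite qlog_lt -subr_gt0 => zx.
  have [N _ hN] := near_infty_natSinv_lt (PosNum zx).
  by exists N => // n /hN /=; rewrite logd_lt// ltrBrDl.
Qed.

End log_subharmonic.

(** * Strongly subharmonic functions *)

Section psh.
Context {R : realType}.
Local Open Scope ereal_scope.
Implicit Types (Omega A K : set (quat R)) (u v : quat R -> \bar R) (q : quat R).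

Lemma subharmonicS (D E : set (R * R)) (u : R * R -> \bar R) :
  D `<=` E -> subharmonic E u -> subharmonic D u.
Proof.
move=> DE [uu ufin su]; split; first exact: usc_onS uu.
  by move=> z /DE; exact: ufin.
by move=> z r r0 BD; apply: su => //; exact: subset_trans DE.
Qed.

(* Strong subharmonicity without the requirement [u <> -oo]. *)
Definition weakly_ssh Omega u : Prop :=
  [/\ usc_on Omega u, forall q, Omega q -> u q < +oo &
   forall I, imag_unit I -> forall a b : quat R,
     subharmonic [set z | Omega (a + slice I z * b)%R]
                 (fun z => u (a + slice I z * b)%R)].

Lemma strongly_subharmonicP Omega u : strongly_subharmonic Omega u <->
  weakly_ssh Omega u /\ exists2 q, Omega q & u q != -oo.
Proof.
split=> [[uu ufin une pu]|[[uu ufin pu] une]]; split => //.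
  by split=> // I /pu[].
by move=> I I1; split => //; exact: pu.
Qed.

Lemma weakly_sshS Omega A u : A `<=` Omega -> weakly_ssh Omega u -> weakly_ssh A u.
Proof.
move=> AO [uu ufin pu]; split; first exact: usc_onS uu.
  by move=> q /AO; exact: ufin.
by move=> I I1 a b; apply: subharmonicS (pu I I1 a b) => z; exact: AO.
Qed.

Lemma open_line (I a b : quat R) Omega : open Omega ->
  open [set z | Omega (a + slice I z * b)%R].
Proof. by move=> oO; apply: open_comp oO => z _; exact: line_continuous. Qed.

Lemma weakly_ssh_glue Omega A K u v : open Omega -> open A -> A `<=` Omega ->
  K `<=` A -> open (Omega `\` K) -> weakly_ssh A u -> weakly_ssh Omega v ->
  (forall q, A q -> ~ K q -> u q <= v q) ->
  weakly_ssh Omega (fun q => if q \in K then maxe (u q) (v q) else v q).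
Proof.
move=> oO oA AO KA oOK [uu ufin pu] [uv vfin pv] uv_le; split.
- exact: usc_on_glue uv_le.
- move=> q Oq; case: ifPn => [/set_mem Kq|_]; last exact: vfin.
  by rewrite gt_max ufin ?vfin//; exact: KA.
- move=> I I1 a b.
  have := @subharmonic_glue R _ _ [set z | K (a + slice I z * b)%R] _ _
    (@open_line I a b _ oO) (@open_line I a b _ oA) (fun z => @AO _) (fun z => @KA _)
    (@open_line I a b _ oOK) (pu I I1 a b) (pv I I1 a b) (fun z => @uv_le _).
  by congr subharmonic.
Qed.

Lemma weakly_ssh_affine Omega u (C c : R) : (0 < C)%R -> weakly_ssh Omega u ->
  weakly_ssh Omega (fun q => C%:E * u q + c%:E).
Proof.
move=> C0 [uu ufin pu].
split; first exact: usc_on_affine.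
- by move=> q /ufin; exact: affine_lty.
- by move=> I I1 a b; apply: subharmonic_affine => //; exact: pu.
Qed.

(* Right multiplications are complex linear for every structure [v |-> I v]. *)
Definition right_dilation (q0 h q : quat R) : quat R := (q + (q - q0) * h)%R.

Lemma right_dilation_continuous (q0 h : quat R) : continuous (right_dilation q0 h).
Proof.
move=> q; have c : {for q, continuous (fun q : quat R => (q - q0) * h)%R}.
  apply: (@continuous_comp _ _ _ (fun q => q - q0)%R (fun q : quat R => q * h)%R).
    exact: (cvgB cvg_id (cvg_cst _)).
  exact: qmulr_continuous.
exact: (cvgD cvg_id c).
Qed.

Lemma weakly_ssh_right_dilation Omega u (q0 h : quat R) : weakly_ssh Omega u ->
  weakly_ssh (right_dilation q0 h @^-1` Omega) (u \o right_dilation q0 h).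
Proof.
move=> [uu ufin pu]; split.
- exact: usc_on_comp (@right_dilation_continuous q0 h).
- by move=> q; exact: ufin.
- move=> I I1 a b.
  (* The factor [slice I z] stays on the left, so a complex line goes to the complex line of
     direction [b + b * h] for the same [I]. *)
  have E z : right_dilation q0 h (a + slice I z * b)%R =
      (a + (a - q0) * h + slice I z * (b + b * h))%R.
    rewrite /right_dilation mulrDr mulrA addrACA; congr (_ + _)%R.
    by rewrite addrAC mulrDl.
  have := pu I I1 (a + (a - q0) * h)%R (b + b * h)%R.
  congr subharmonic; apply/funext => z /=; last by rewrite E.
  by rewrite E.
Qed.

Lemma weakly_ssh_qlog (q0 : quat R) : weakly_ssh setT (qlog q0).
Proof.
split; first exact: qlog_usc.
- by move=> q _; rewrite /qlog; case: ifP; rewrite ?ltry ?ltNyr.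
- by move=> I I1 a b; apply: subharmonicS (qlog_subharmonic a b q0 I1).
Qed.

(** Replaces the limsup by uniform two-sided bounds on a punctured Euclidean ball, the form that
    gluing can check. *)
Lemma log_poleP (q0 : quat R) u :
  (limf_esup (fun q => `|u q - (ln (qnorm (q - q0)))%:E|) q0^' < +oo) <->
  exists B r : R, (0 < r)%R /\ forall q, (0 < qnorm (q - q0) < r)%R ->
    (ln (qnorm (q - q0)) - B)%:E <= u q <= (ln (qnorm (q - q0)) + B)%:E.
Proof.
have absE (x : \bar R) (l B : R) :
    (`|x - l%:E| <= B%:E) = ((l - B)%:E <= x <= (l + B)%:E).
  case: x => [x| |]; first by rewrite /= !lee_fin ler_distl.
  - by rewrite /= leey.
  - by [].
rewrite /limf_esup; split.
  move=> /ereal_inf_lt[_ [V Vq0 <-] supV].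
  have /nbhs_qball[r r0 hr] : nbhs q0 [set q | q != q0 -> V q] by exact: Vq0.
  have [B hB] : exists B : R, forall q, V q ->
      `|u q - (ln (qnorm (q - q0)))%:E| <= B%:E.
    have le_sup q : V q -> `|u q - (ln (qnorm (q - q0)))%:E| <=
        ereal_sup [set `|u q - (ln (qnorm (q - q0)))%:E| | q in V].
      by move=> Vq; apply: ereal_sup_ubound; exists q.
    move: supV le_sup; case: (ereal_sup _) => [B| |]// _ le_sup; first by exists B.
    by exists 0%R => q /le_sup /le_trans; apply; rewrite leNye.
  exists B, r; split => // q /andP[q_gt0 qr]; rewrite -absE; apply: hB.
  by apply: hr => //; rewrite -subr_eq0 -qnorm_eq0 gt_eqF.
move=> [B [r [r0 hB]]].
apply: (@le_lt_trans _ _ B%:E); last exact: ltry.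
apply: ge_ereal_inf; exists (ereal_sup [set `|u q - (ln (qnorm (q - q0)))%:E| |
  q in [set q | 0 < qnorm (q - q0) < r]%R]).
  exists [set q | 0 < qnorm (q - q0) < r]%R => //.
  apply/nbhs_qball; exists r => // q qr qq0 /=.
  by rewrite qr andbT qnorm_gt0 subr_eq0.
by apply: ge_ereal_sup => _ [q /= /hB qB <-]; rewrite absE.
Qed.

(** The pole estimate also shows that [u] is not identically [-oo]: its lower bound is finite at
    [q0 + t] for a small real [t > 0]. *)
Lemma ssh_intro Omega (q0 : quat R) u : open Omega -> Omega q0 -> weakly_ssh Omega u ->
  (forall q, Omega q -> u q < 0) ->
  (exists B r : R, (0 < r)%R /\ forall q, (0 < qnorm (q - q0) < r)%R ->
    (ln (qnorm (q - q0)) - B)%:E <= u q <= (ln (qnorm (q - q0)) + B)%:E) ->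
  ssh Omega q0 u.
Proof.
move=> oO Oq0 wu u0 pole; split => //; last exact/log_poleP.
apply/strongly_subharmonicP; split => //.
have [B [r [r0 hB]]] := pole.
have /nbhs_qball[d d0 dO] : nbhs q0 Omega by exact: open_nbhs_nbhs.
pose t := (Num.min r d / 2)%R.
have m0 : (0 < Num.min r d)%R by rewrite lt_min r0.
have t0 : (0 < t)%R by rewrite divr_gt0.
have [tr td] : (t < r /\ t < d)%R.
  have [h1 h2] : (Num.min r d <= r /\ Num.min r d <= d)%R.
    by rewrite !ge_min !lexx orbT.
  by rewrite /t; split; lra.
have E : qnorm (q0 + t%:A - q0)%R = t.
  rewrite addrC addKr qnormE.
  have -> : qdot (t%:A : quat R) t%:A = (t ^+ 2)%R by rewrite /qdot !qcoordE; ring.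
  by rewrite sqrtr_sqr ger0_norm// ltW.
exists (q0 + t%:A)%R; first by apply: dO; rewrite E.
have := hB (q0 + t%:A)%R; rewrite E t0 tr => /(_ isT) /andP[h _].
by rewrite -ltNye; apply: lt_le_trans h; exact: ltNyr.
Qed.

End psh.

(** * The Green function *)

Section green.
Context {R : realType}.
Variables (Omega : set (quat R)) (rho : quat R -> R) (q0 : quat R).
Hypothesis open_Omega : open Omega.
Hypothesis bounded_Omega : bounded_set Omega.
Hypothesis rho_ssh : weakly_ssh Omega (fun q => (rho q)%:E).
Hypothesis rho_lt0 : forall q, Omega q -> rho q < 0.
Hypothesis rho_exh : forall c : R, c < 0 ->
  relatively_compact_in [set q | Omega q /\ rho q < c] Omega.
Hypothesis Oq0 : Omega q0.

Let s := ssh_sup Omega q0.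

Lemma ssh_sup_ge u q : ssh Omega q0 u -> (u q <= s q)%E.
Proof. by move=> su; apply: ereal_sup_ubound; exists u. Qed.

Lemma ssh_sup_le0 q : Omega q -> (s q <= 0)%E.
Proof.
move=> Oq; apply: ge_ereal_sup => _ [u [_ u0 _] <-].
by apply: ltW; exact: u0.
Qed.

(* The exhaustion [C rho], glued near [q0] to a normalized logarithm. *)
Lemma exhaustion_competitor : exists (v : quat R -> \bar R) (C c0 r : R),
  [/\ ssh Omega q0 v, 0 < C, c0 < 0 & 0 < r] /\
  [/\ forall q, qnorm (q - q0) < r -> Omega q /\ rho q < c0,
      forall q, Omega q -> c0 <= rho q -> ((C * rho q)%:E <= v q)%E &
      forall q, Omega q -> q != q0 -> (-oo < v q)%E].
Proof.
have [Rad Rad0 hRad] := bounded_qnorm q0 bounded_Omega.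
(* This is [log (|q - q0| / Rad)], negative on [Omega] by the choice of [Rad]. *)
pose L q := (1%:E * qlog q0 q + (- ln Rad)%:E)%E.
have wL : weakly_ssh setT L by exact: weakly_ssh_affine (weakly_ssh_qlog q0).
have LE q : q != q0 -> L q = (ln (qnorm (q - q0)) - ln Rad)%:E.
  by move=> /negbTE qq0; rewrite /L mul1e /qlog qq0.
have Lq0 : L q0 = -oo%E by rewrite /L mul1e /qlog eqxx.
have L0 q : Omega q -> (L q < 0)%E.
  move=> Oq; have [->|qq0] := eqVneq q q0; first by rewrite Lq0.
  rewrite LE// lte_fin subr_lt0 ltr_ln ?posrE ?hRad// qnorm_gt0 subr_eq0//.
pose c0 := rho q0 / 2.
have rq0 := rho_lt0 Oq0.
have c00 : c0 < 0 by rewrite /c0; lra.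
have [r r0 hr] : exists2 r : R, 0 < r &
    forall q, qnorm (q - q0) < r -> Omega q /\ rho q < c0.
  apply/nbhs_qball; have [urho _ _] := rho_ssh.
  have : ((rho q0)%:E < c0%:E)%E by rewrite lte_fin /c0; lra.
  move=> /(urho _ Oq0); rewrite near_withinE => h.
  have hO : \forall q \near q0, Omega q by exact: open_nbhs_nbhs.
  by move: h hO; apply: filterS2 => q h Oq; split => //; rewrite -lte_fin; exact: h.
(* Large enough that on the shell between the radii [r / 2] and [r], where [rho < c0], the function
   [C * rho] lies below [ln (r / 2) - ln Rad], hence below [L]. *)
pose C := Num.max 1 ((ln Rad - ln (r / 2)) / - c0).
have C0 : 0 < C by rewrite lt_max ltr01.
have CC : C * c0 <= ln (r / 2) - ln Rad.
  have : (ln Rad - ln (r / 2)) / - c0 <= C by rewrite le_max lexx orbT.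
  by rewrite ler_pdivrMr ?oppr_gt0//; lra.
(* The glued function is [L] within distance [r] of [q0], which gives the pole, and the maximum with
   [C * rho] on [K]; points with [c0 <= rho] belong to [K]. *)
pose K := [set q | Omega q /\ r <= qnorm (q - q0)].
pose A := [set q | Omega q /\ r / 2 < qnorm (q - q0)].
have oA : open A.
  apply: openI => //.
  apply: (@open_comp _ _ (fun q => qnorm (q - q0)) [set x | r / 2 < x]).
    by move=> q _; exact: qnorm_continuous.
  exact: open_gt.
have oOK : open (Omega `\` K).
  rewrite (_ : _ `\` _ = Omega `&` [set q | qnorm (q - q0) < r]).
    apply: openI => //.
    apply: (@open_comp _ _ (fun q => qnorm (q - q0)) [set x | x < r]).
      by move=> q _; exact: qnorm_continuous.
    exact: open_lt.
  apply/seteqP; split => q [Oq].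
    by move=> nK; split => //=; rewrite ltNge; apply/negP => h; exact: nK.
  by move=> /= h; split => // -[_]; rewrite leNgt h.
pose f q := (C%:E * (rho q)%:E + 0%:E)%E.
have wf : weakly_ssh A f.
  apply: weakly_ssh_affine => //; apply: weakly_sshS rho_ssh.
  by move=> q [].
have fE q : f q = (C * rho q)%:E by rewrite /f adde0 -EFinM.
have fL q : A q -> ~ K q -> (f q <= L q)%E.
  move=> [Oq rq] nK.
  have qr : qnorm (q - q0) < r by rewrite ltNge; apply/negP => h; exact: nK.
  have [_ rhoq] := hr _ qr.
  have q_gt0 : 0 < qnorm (q - q0) by apply: lt_trans rq; rewrite divr_gt0.
  rewrite fE LE; last by rewrite -subr_eq0 -qnorm_gt0.
  rewrite lee_fin; apply: (@le_trans _ _ (C * c0)); first by rewrite ler_pM2l// ltW.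
  apply: (le_trans CC); rewrite lerD2r ler_ln ?posrE ?divr_gt0//.
  exact: ltW.
pose v q := if q \in K then maxe (f q) (L q) else L q.
have AO : A `<=` Omega by move=> q [].
have KA : K `<=` A.
  by move=> q [Oq rq]; split => //; apply: lt_le_trans rq; lra.
have wv : weakly_ssh Omega v.
  exact: weakly_ssh_glue (weakly_sshS (@subsetT _ _) wL) fL.
have Lv q : (L q <= v q)%E.
  by rewrite /v; case: ifP => // _; rewrite le_max lexx orbT.
exists v, C, c0, r; split; split => //.
- apply: ssh_intro => //.
    move=> q Oq; rewrite /v; case: ifP => _; last exact: L0.
    by rewrite gt_max L0// fE lte_fin nmulr_llt0 ?rho_lt0// C0.
  exists `|ln Rad|, r; split => // q /andP[q_gt0 qr].
  have qq0 : q != q0 by rewrite -subr_eq0 -qnorm_gt0.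
  rewrite /v memNset; last by move=> [_]; rewrite leNgt qr.
  rewrite LE// !lee_fin; apply/andP.
  by have := ler_norm (ln Rad); have := ler_norm (- ln Rad); rewrite normrN; lra.
- move=> q Oq c0q; rewrite /v mem_set; first by rewrite fE le_max lexx.
  split => //; rewrite leNgt; apply/negP => /hr[_]; rewrite ltNge.
  by rewrite c0q.
- by move=> q Oq qq0; apply: lt_le_trans (Lv q); rewrite LE// ltNyr.
Qed.

Lemma compact_tube (K : set (quat R)) : compact K -> K `<=` Omega ->
  exists2 e : R, 0 < e & forall q p, K q -> qnorm (p - q) < e -> Omega p.
Proof.
move=> cK KO.
have loc q : K q -> \forall q' \near q & e \near (0 : R)^'+,
    forall p, qnorm (p - q') < e -> Omega p.
  move=> /KO Oq.
  have /nbhs_qball[d d0 hd] : nbhs q Omega by exact: open_nbhs_nbhs.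
  have d20 : 0 < d / 2 by rewrite divr_gt0.
  exists ([set q' | qnorm (q' - q) < d / 2], [set e | 0 < e < d / 2]).
    split; first by apply/nbhs_qball; exists (d / 2).
    near=> e => /=; apply/andP; split; near: e; first exact: nbhs_right_gt.
    exact: nbhs_right_lt.
  move=> [q' e] /= [qq' /andP[_ ed]] p pq'; apply: hd.
  have := ler_qnormD (p - q') (q' - q); rewrite subrKA; lra.
have h := (compact_near_coveringP _).1 cK _ _
  (fun (e : R) q' => forall p, qnorm (p - q') < e -> Omega p) _ loc.
have : \forall e \near (0 : R)^'+, 0 < e /\
    K `<=` (fun q' => forall p, qnorm (p - q') < e -> Omega p).
  near=> e; split; first by near: e; exact: nbhs_right_gt.
  by near: e; exact: h.
by move=> /filter_ex[e [e0 he]]; exists e => // q p /he; exact.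
Unshelve. all: by end_near. Qed.

(** Each member [u] is transported by the dilation, lowered by [eps] and glued to the competitor
    [v]. The result is again a member, so its value at [q] is at most [s q]. *)
Lemma ssh_sup_dilation (eps : R) : 0 < eps -> exists2 d : R, 0 < d &
  forall h q, qnorm h < d -> Omega q -> Omega (right_dilation q0 h q) ->
    (s (right_dilation q0 h q) <= s q + eps%:E)%E.
Proof.
move=> eps0.
have [v [C [c0 [r [[sv C0 c00 r0] [hr hC hv]]]]]] := exhaustion_competitor.
have [Rad Rad0 hRad] := bounded_qnorm q0 bounded_Omega.
(* Where [rho >= c], the bound [c >= c0] gives [v >= C * rho], and [c >= - eps / C] gives
   [C * rho >= - eps]. *)
pose c := Num.max c0 (- eps / C).
have c_lt0 : c < 0.
  by rewrite gt_max c00/= ltr_pdivrMr// mul0r oppr_lt0.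
pose K := closure [set q | Omega q /\ rho q < c].
have [cK KO] := rho_exh c_lt0.
have outK q : Omega q -> ~ K q -> ((- eps)%:E <= v q)%E.
  move=> Oq nK; have cq : c <= rho q.
    by rewrite leNgt; apply/negP => qc; apply: nK; apply: subset_closure.
  have c0q : c0 <= rho q by apply: le_trans cq; rewrite le_max lexx.
  apply: le_trans (hC _ Oq c0q); rewrite lee_fin mulrC -ler_pdivrMr//.
  by apply: le_trans cq; rewrite le_max lexx orbT.
have ballK q : qnorm (q - q0) < r -> K q.
  move=> /hr[Oq qc]; apply: subset_closure; split => //.
  by rewrite lt_max qc.
have [e e0 he] := compact_tube cK KO.
(* The first bound keeps the displacement [|q - q0| |h|] below [e], so that [K] is sent into
   [Omega]; the second keeps [1 + h] away from 0. *)
exists (Num.min (e / Rad) (1 / 2)).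
  by rewrite lt_min !divr_gt0.
move=> h; rewrite lt_min => q /andP[he1 h1].
have oOK : open (Omega `\` K).
  rewrite setDE; apply: openI => //; apply: closed_openC; exact: closed_closure.
pose A := Omega `&` (right_dilation q0 h @^-1` Omega).
have oA : open A.
  apply: openI => //; apply: open_comp open_Omega => p _.
  exact: right_dilation_continuous.
have KA : K `<=` A.
  move=> p Kp; split; first exact: KO.
  apply: (he p) => //; rewrite /right_dilation addrC addKr qnormM.
  have pRad := hRad _ (KO _ Kp).
  have := qnorm_ge0 h; have := qnorm_ge0 (p - q0).
  by move: he1; rewrite ltr_pdivlMr//; nra.
pose k : R := qnorm (1 + h).
have k0 : 0 < k.
  have := ler_qnormD (1 + h) (- h); rewrite addrK qnormN -/k.
  have -> : qnorm (1 : quat R) = 1.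
    by rewrite qnormE (_ : qdot 1 1 = 1) ?sqrtr1// /qdot !qcoordE; ring.
  lra.
have dilE p : qnorm (right_dilation q0 h p - q0) = qnorm (p - q0) * k.
  by rewrite -qnormM mulrDr mulr1 /right_dilation addrAC.
move=> Oq Oq'; apply: ge_ereal_sup => _ [u su <-]; rewrite -leeBlDr//.
have [/strongly_subharmonicP[wu _] u0 /log_poleP[Bu [ru [ru0 hBu]]]] := su.
have [/strongly_subharmonicP[wv _] v0 /log_poleP[Bv [rv [rv0 hBv]]]] := sv.
pose f p := (1%:E * (u \o right_dilation q0 h) p + (- eps)%:E)%E.
have fE p : f p = (u (right_dilation q0 h p) - eps%:E)%E by rewrite /f mul1e.
have wf : weakly_ssh A f.
  apply: weakly_ssh_affine => //.
  apply: weakly_sshS (weakly_ssh_right_dilation q0 h wu) => p [_ h']; exact: h'.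
have f_le p : A p -> (f p < (- eps)%:E)%E.
  move=> [_ /u0]; rewrite fE; case: (u _) => [x| |]//.
    by rewrite -EFinB !lte_fin; lra.
  by move=> _; rewrite addNye ltNyr.
have fv p : A p -> ~ K p -> (f p <= v p)%E.
  by move=> Ap nKp; apply: le_trans (ltW (f_le _ Ap)) (outK _ _ nKp); case: Ap.
pose w p := if p \in K then maxe (f p) (v p) else v p.
have vw p : (v p <= w p)%E.
  by rewrite /w; case: ifP => // _; rewrite le_max lexx orbT.
have sw : ssh Omega q0 w.
  apply: ssh_intro => //.
  - by apply: weakly_ssh_glue fv => // p [].
  - move=> p Op; rewrite /w; case: ifPn => [/set_mem Kp|_]; last exact: v0.
    rewrite gt_max v0// andbT; apply: lt_trans (f_le _ (KA _ Kp)) _.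
    by rewrite lte_fin oppr_lt0.
  (* The dilation multiplies distances to [q0] by [k]: this costs [ln k] in the bound for [u] and
     shrinks its radius to [ru / k]. The lower bound comes from [v] alone. *)
  exists (Num.max (`|Bv|) (`|ln k| + `|Bu|)), (Num.min rv (ru / k)).
  split; first by rewrite lt_min rv0 divr_gt0.
  move=> p /andP[p0]; rewrite lt_min ltr_pdivlMr// => /andP[prv pru].
  have /andP[v1 v2] : ((ln (qnorm (p - q0)) - Bv)%:E <= v p <= (ln (qnorm (p - q0)) + Bv)%:E)%E.
    by apply: hBv; rewrite p0.
  set B := Num.max _ _.
  have BvB : `|Bv| <= B by rewrite le_max lexx.
  have BuB : `|ln k| + `|Bu| <= B by rewrite le_max lexx orbT.
  apply/andP; split.
    apply: le_trans (vw p); apply: le_trans v1; rewrite lee_fin.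
    by have := ler_norm Bv; lra.
  have v3 : (v p <= (ln (qnorm (p - q0)) + B)%:E)%E.
    by apply: (le_trans v2); rewrite lee_fin; have := ler_norm Bv; lra.
  rewrite /w; case: ifP => // _; rewrite ge_max v3 andbT fE.
  have /andP[_ u2] : ((ln (qnorm (right_dilation q0 h p - q0)) - Bu)%:E <=
      u (right_dilation q0 h p) <= (ln (qnorm (right_dilation q0 h p - q0)) + Bu)%:E)%E.
    by apply: hBu; rewrite dilE pru mulr_gt0.
  rewrite leeBlDr//; apply: (le_trans u2).
  rewrite -EFinD lee_fin dilE lnM ?posrE//.
  by have := ler_norm (ln k); have := ler_norm Bu; lra.
rewrite -fE; apply: le_trans (ssh_sup_ge q sw).
rewrite /w; case: ifPn => [_|/negP Kq]; first by rewrite le_max lexx.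
by apply: fv => // Kq'; apply: Kq; rewrite inE.
Qed.

(** The dilation with [h = (p - q0)^-1 (p' - p)] carries [p] to [p'], and [|h|] is
    [|p' - p| / |p - q0|]. Using it from [q] to [p] and from [p] to [q] gives the two
    inequalities. *)
Lemma ssh_sup_near (q : quat R) (eps : R) : Omega q -> q != q0 -> 0 < eps ->
  \forall p \near q, [/\ Omega p, p != q0, (s p <= s q + eps%:E)%E &
    (s q <= s p + eps%:E)%E].
Proof.
move=> Oq qq0 eps0; have [d d0 hd] := ssh_sup_dilation eps0.
have dil (p p' : quat R) : Omega p -> Omega p' -> p != q0 ->
    qnorm (p' - p) < d * qnorm (p - q0) -> (s p' <= s p + eps%:E)%E.
  move=> Op Op' pq0 pp'; pose h := qinv (p - q0) * (p' - p).
  have p0 : p - q0 != 0 by rewrite subr_eq0.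
  have E : right_dilation q0 h p = p'.
    by rewrite /right_dilation /h mulrA qmulqV// mul1r addrC subrK.
  rewrite -E; apply: hd => //; last by rewrite E.
  have : (p - q0) * h = p' - p by rewrite /h mulrA qmulqV// mul1r.
  move=> /(congr1 (@qnorm R)); rewrite qnormM => hE.
  by move: pp'; rewrite -hE mulrC ltr_pM2r// qnorm_gt0.
have k0 : 0 < qnorm (q - q0) by rewrite qnorm_gt0 subr_eq0.
have hO : \forall p \near q, Omega p by exact: open_nbhs_nbhs.
(* Staying within half the distance to the pole bounds [|p - q0|] below by [|q - q0| / 2], so one
   [d] works from either endpoint. *)
have h1 : \forall p \near q, qnorm (p - q) < Num.min (qnorm (q - q0) / 2)
    (d * (qnorm (q - q0) / 2)).
  apply/nbhs_qball; eexists; last by move=> p; exact.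
  by rewrite lt_min divr_gt0//= mulr_gt0// divr_gt0.
move: hO h1; apply: filterS2 => p Op; rewrite lt_min => /andP[p1 p2].
have p3 : qnorm (q - q0) / 2 < qnorm (p - q0).
  have := ler_qnormD (q - p) (p - q0); rewrite subrKA (qnorm_distC q p); lra.
have pq0 : p != q0 by rewrite -subr_eq0 -qnorm_gt0; lra.
split => //; first by apply: dil => //; nra.
by apply: dil => //; rewrite qnorm_distC; nra.
Qed.

Lemma ssh_sup_fin (q : quat R) : Omega q -> q != q0 -> s q \is a fin_num.
Proof.
move=> Oq qq0; have [v [_ [_ [_ [[sv _ _ _] [_ _ hv]]]]]] := exhaustion_competitor.
rewrite fin_numElt (lt_le_trans (hv _ Oq qq0) (ssh_sup_ge q sv))/=.
exact: le_lt_trans (ssh_sup_le0 Oq) (ltry 0).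
Qed.

Lemma ssh_green_ge (q : quat R) : Omega q -> (s q <= ssh_green Omega q0 q)%E.
Proof.
move=> Oq; apply: le_ereal_inf_tmp => _ [V Vq <-].
apply: ereal_sup_ubound; exists q => //.
have : nbhs q (fun p => Omega p -> V p) by exact: Vq.
by move=> /nbhs_singleton; exact.
Qed.

Lemma ssh_green_le0 (q : quat R) : (ssh_green Omega q0 q <= 0)%E.
Proof.
apply: ge_ereal_inf; exists (ereal_sup [set s p | p in Omega]).
  by exists Omega => //; apply: nearW => p.
by apply: ge_ereal_sup => _ [p Op <-]; exact: ssh_sup_le0.
Qed.

Lemma ssh_greenE (q : quat R) : Omega q -> q != q0 -> ssh_green Omega q0 q = s q.
Proof.
move=> Oq qq0; apply/eqP; rewrite eq_le ssh_green_ge// andbT.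
apply/lee_addgt0Pr => eps eps0.
apply: ge_ereal_inf; exists (ereal_sup [set s p | p in [set p | s p <= s q + eps%:E]%E]).
  exists [set p | s p <= s q + eps%:E]%E => //.
  by have := ssh_sup_near Oq qq0 eps0; apply: filterS => p [].
by apply: ge_ereal_sup => _ [p /= ? <-].
Qed.

Lemma ssh_green_boundary (p : quat R) : boundary Omega p ->
  ssh_green Omega q0 q @[q --> within Omega (nbhs p)] --> (0%E : \bar R).
Proof.
rewrite /boundary (_ : interior Omega = Omega) => [[_ nOp]|]; last first.
  exact: (interior_id Omega).1.
have [v [C [c0 [r [[sv C0 c00 r0] [hr hC hv]]]]]] := exhaustion_competitor.
(* The closure of a sublevel set lies inside [Omega], so its complement is a neighbourhood of the
   boundary point [p]. *)
have near_rho c : c < 0 -> \forall q \near within Omega (nbhs p), Omega q /\ c <= rho q.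
  move=> /rho_exh[_ KO]; rewrite near_withinE.
  have : nbhs p (~` closure [set q | Omega q /\ rho q < c]).
    apply: open_nbhs_nbhs; split; last by move=> /KO.
    exact/closed_openC/closed_closure.
  apply: filterS => q nq Oq; split => //; rewrite leNgt; apply/negP => qc.
  by apply: nq; apply: subset_closure.
apply: (@squeeze_cvge _ _ _ R (fun q => (C * rho q)%:E) _ (fun=> 0%E)).
- have := near_rho _ c00; apply: filterS => q [Oq c0q].
  rewrite ssh_green_le0 andbT; apply: le_trans (ssh_green_ge Oq).
  exact: le_trans (hC _ Oq c0q) (ssh_sup_ge q sv).
- apply: cvg_EFin; first by apply: nearW.
  apply/cvgrPdist_lt => e e0.
  (* At this level [C * rho >= - (e / 2)]; the halving produces the strict bound by [e]. *)
  have c_lt0 : - (e / C / 2) < 0 by rewrite oppr_lt0 !divr_gt0.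
  have := near_rho _ c_lt0; apply: filterS => q [Oq cq] /=.
  have := rho_lt0 Oq => rq.
  rewrite sub0r normrN ltr0_norm; last by rewrite nmulr_llt0.
  have : C * - (e / C / 2) <= C * rho q by rewrite ler_pM2l.
  have -> : C * - (e / C / 2) = - (e / 2) by field; rewrite gt_eqF.
  lra.
- exact: cvg_cst.
Qed.

Lemma ssh_green_continuous :
  {within Omega `\ q0, continuous (ssh_green Omega q0)}.
Proof.
apply/subspace_continuousP => q [Oq /eqP qq0].
suff : ssh_green Omega q0 p @[p --> within (Omega `\ q0) (nbhs q)] -->
    (fine (s q))%:E by rewrite fineK ?ssh_sup_fin// -ssh_greenE.
have nearq (eps : R) : 0 < eps -> \forall p \near within (Omega `\ q0) (nbhs q),
    `|fine (s q) - fine (ssh_green Omega q0 p)| <= eps.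
  move=> eps0; rewrite near_withinE.
  have := ssh_sup_near Oq qq0 eps0; apply: filterS => p [Op pq0 h1 h2] _.
  rewrite ssh_greenE//.
  move: h1 h2; rewrite -(fineK (ssh_sup_fin Oq qq0)) -(fineK (ssh_sup_fin Op pq0)).
  by rewrite -!EFinD !lee_fin !fineK ?ssh_sup_fin// ler_norml => h1 h2; apply/andP; split; lra.
apply: cvg_EFin.
  rewrite near_withinE; apply: nearW => p [Op /eqP pq0].
  by rewrite ssh_greenE// ssh_sup_fin.
apply/cvgrPdist_lt => e e0.
have e20 : 0 < e / 2 by rewrite divr_gt0.
by have := nearq _ e20; apply: filterS => p /= h; apply: (le_lt_trans h); lra.
Qed.

End green.

Theorem theorem7p10 (R : realType) (Omega : set (quat R))
    (dom_Omega : domain Omega) (bounded_Omega : bounded_set Omega)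
    (rho : quat R -> R)
    (rho_cont : {within Omega, continuous rho})
    (rho_ssh : strongly_subharmonic Omega (fun q => (rho q)%:E))
    (rho_lt0 : forall q, Omega q -> rho q < 0)
    (rho_exh : forall c : R, c < 0 ->
       relatively_compact_in [set q | Omega q /\ rho q < c] Omega) :
  forall q0 : quat R, Omega q0 ->
    (forall p : quat R, boundary Omega p ->
       ssh_green Omega q0 q @[q --> within Omega (nbhs p)] --> (0%E : \bar R)) /\
    {within Omega `\ q0, continuous (ssh_green Omega q0)}.
Proof.
move=> q0 Oq0; have [_ _ oO] := dom_Omega.
have [wrho _] := (strongly_subharmonicP _ _).1 rho_ssh.
split; last exact: (ssh_green_continuous oO bounded_Omega wrho).
by move=> p; exact: (ssh_green_boundary oO bounded_Omega wrho).
Qed.
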